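(* Let $n\ge 1$, let $A_n$ be the $2^n$-dimensional real Cayley--Dickson algebra, and put $N=2^n$. Multiplication $A_n\times A_n\to A_n$ admits a real bilinear algorithm of length at most $$(9n-15)2^{n-1}+10 .$$ It can be performed using $O(n2^n)=O(N\log N)$ real arithmetic operations, and the construction (the recursive algorithm $\mathsf M_n$ described in the context) admits a matrix-free sequential implementation using $O(N)$ auxiliary storage. The implied constants are absolute (independent of $n$).
   Context: **Cayley--Dickson tower.** $A_0:=\mathbb R$ with $\bar r=r$. Recursively $A_n:=A_{n-1}\oplus A_{n-1}$ with $$\overline{(a,b)}=(\bar a,-b),\qquad (a,b)(c,d)=\bigl(ac-\bar d\,b,\;da+b\bar c\bigr).$$ The standard (recursive, concatenated) basis identifies $A_n$ with $\mathbb R^{2^n}$ and gives its Euclidean inner product $\langle\cdot,\cdot\rangle$. Real scalars are identified with multiples of the unit of $A_n$. Put $\operatorname{Re}(x)=\frac{x+\bar x}{2}$ (identified with its scalar coefficient), $\operatorname{Im}(x)=\frac{x-\bar x}{2}$, $V_n:=\operatorname{Im}(A_n)=\{x\in A_n:\bar x=-x\}$, so $A_n=\mathbb R\oplus V_n$. **Complexity notions.** A real bilinear algorithm of length $r$ for a bilinear map $\mu:U_1\times U_2\to W$ of finite-dimensional real vector spaces is an expression $\mu(x,y)=\sum_{j=1}^r\alpha_j(x)\beta_j(y)w_j$ with $\alpha_j\in U_1^*$, $\beta_j\in U_2^*$, $w_j\in W$. Real arithmetic operations (additions, subtractions, multiplications, including multiplications by fixed constants) are counted in the unit-cost model. Logarithms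 are to base two. Auxiliary storage is the number of real coefficients stored in addition to the input and output storage. ''Matrix-free'' means that no multiplication table or dense matrix is constructed. **The algorithm.** Let $V_n^{\mathbb C}=V_n\otimes_{\mathbb R}\mathbb C$, $\mathbb C=\mathbb R(\iota)$, $\iota^2=-1$, with the Cayley--Dickson involution extended $\mathbb C$-linearly and $\langle z,w\rangle_{\mathrm{bil}}=\sum_j z_jw_j$ (no conjugation). For $n\ge2$ every element of $V_n^{\mathbb C}$ (resp. $V_n$) is uniquely $(u,\gamma+s)$ with $u,s\in V_{n-1}^{\mathbb C}$, $\gamma\in\mathbb C$ (resp. $u,s\in V_{n-1}$, $\gamma\in\mathbb R$). $\operatorname{Re}_{\mathrm c},\operatorname{Im}_{\mathrm c}$ denote coefficientwise real and imaginary parts. - $\mathsf C_n(X,Y)$ for $n\ge 1$, $X,Y\in V_n^{\mathbb C}$: if $n=1$ return $0$. Otherwise write $X=(u,\gamma+s)$, $Y=(v,\delta+t)$; set $Z_\pm\leftarrow\mathsf C_{n-1}(u\pm\iota s,v\pm\iota t)$, $\lambda\leftarrow\langle s,v\rangle_{\mathrm{bil}}-\langle t,u\rangle_{\mathrm{bil}}$, $F\leftarrow (Z_++Z_-)/2+\gamma t-\delta s$, $G\leftarrow\lambda+\delta u-\gamma v+\iota(Z_+-Z_-)/2$; return $(F,G)$. - $\mathsf R_n(X,Y)$ for $n\ge 1$, $X,Y\in V_n$: if $n=1$ return $0$. Otherwise write $X=(u,\gamma+s)$, $Y=(v,\delta+t)$; set $Z\leftarrow\mathsf C_{n-1}(u+\iota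 s,v+\iota t)$, $\lambda\leftarrow\langle s,v\rangle-\langle t,u\rangle$, $F\leftarrow\operatorname{Re}_{\mathrm c}Z+\gamma t-\delta s$, $G\leftarrow\lambda+\delta u-\gamma v-\operatorname{Im}_{\mathrm c}Z$; return $(F,G)$. - $\mathsf M_n(x,y)$ for $n\ge 0$, $x,y\in A_n$: if $n=0$ return the real product $xy$. Otherwise set $\alpha=\operatorname{Re}(x)$, $X=\operatorname{Im}(x)$, $\beta=\operatorname{Re}(y)$, $Y=\operatorname{Im}(y)$, $Z\leftarrow\mathsf R_n(X,Y)$; return $(\alpha\beta-\langle X,Y\rangle)+\alpha Y+\beta X+Z$. Complex scalar products are evaluated with three real products: $(a+\iota b)(c+\iota d)=(p-q)+\iota(r-p-q)$ with $p=ac$, $q=bd$, $r=(a+b)(c+d)$. *)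

(* Defs.v *)
From HB Require Import structures.
From mathcomp Require Import all_boot all_order all_algebra.
From mathcomp Require Import reals complex.

Set Implicit Arguments.
Unset Strict Implicit.
Unset Printing Implicit Defensive.
Import Order.TTheory GRing.Theory Num.Theory.
Local Open Scope ring_scope.

(** * The Cayley-Dickson tower *)

(* The tower is defined over any field K: K = R gives A_n, and K = R[i] gives
   its complexification, with the K-linear involution and the K-bilinear
   product. *)
Fixpoint cd (K : fieldType) (n : nat) : vectType K :=
  if n is m.+1 then (cd K m * cd K m)%type else K^o.

Section Tower.
Variable K : fieldType.

Fixpoint cdconj (n : nat) : cd K n -> cd K n :=
  match n with
  | 0 => fun x => x
  | m.+1 => fun x : cd K m * cd K m => (cdconj x.1, - x.2)
  end.

Fixpoint cdmul (n : nat) : cd K n -> cd K n -> cd K n :=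
  match n with
  | 0 => fun x y => (x : K) * (y : K)
  | m.+1 => fun x y : cd K m * cd K m =>
      (cdmul x.1 y.1 - cdmul (cdconj y.2) x.2,
       cdmul y.2 x.1 + cdmul x.2 (cdconj y.1))
  end.

(* The scalar c as a multiple of the unit (1, 0). *)
Fixpoint cdscal (n : nat) (c : K) : cd K n :=
  match n with
  | 0 => c
  | m.+1 => (cdscal m c, 0 : cd K m)
  end.

(* Coordinates in the recursive, concatenated basis. *)
Fixpoint coeffs (n : nat) : cd K n -> seq K :=
  match n with
  | 0 => fun x => [:: (x : K)]
  | m.+1 => fun x : cd K m * cd K m => coeffs x.1 ++ coeffs x.2
  end.

Definition dot (n : nat) (x y : cd K n) : K :=
  \sum_(j < 2 ^ n) (coeffs x)`_j * (coeffs y)`_j.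

Definition cdRe (n : nat) (x : cd K n) : cd K n := 2^-1 *: (x + cdconj x).
Definition cdIm (n : nat) (x : cd K n) : cd K n := 2^-1 *: (x - cdconj x).

(* The unit is the first basis vector. *)
Definition scalar_part (n : nat) (x : cd K n) : K := (coeffs (cdRe x))`_0.

End Tower.

Fixpoint cdmap (K L : fieldType) (f : K -> L) (n : nat) : cd K n -> cd L n :=
  match n with
  | 0 => fun x => f x
  | m.+1 => fun x : cd K m * cd K m => (cdmap f x.1, cdmap f x.2)
  end.

(** * Bilinear algorithms *)

Definition has_bilinear_algorithm (K : fieldType) (U1 U2 W : vectType K)
    (mu : U1 -> U2 -> W) (r : nat) : Prop :=
  exists (alpha : 'I_r -> 'Hom(U1, K^o)) (beta : 'I_r -> 'Hom(U2, K^o))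
         (w : 'I_r -> W),
    forall x y,
      mu x y = \sum_(j < r) ((alpha j x : K) * (beta j y : K)) *: w j.

(* An int because 9n - 15 is negative for n = 1. *)
Definition mul_length (n : nat) : int :=
  (9 * n%:Z - 15) * (2 ^ n.-1)%:Z + 10.

(** * The recursive algorithms C_n, R_n and M_n *)

Section Algorithms.
Variable R : realType.

Definition im_unit : R[i] := Complex 0 1.

Definition cplx (n : nat) (u s : cd R n) : cd R[i] n :=
  cdmap (fun r : R => Complex r 0) u + im_unit *: cdmap (fun r : R => Complex r 0) s.

Definition cdRec (n : nat) : cd R[i] n -> cd R n := @cdmap R[i] R (@complex.Re R) n.
Definition cdImc (n : nat) : cd R[i] n -> cd R n := @cdmap R[i] R (@complex.Im R) n.

(* All three algorithms are total functions on the tower; only the values of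
   C_n and R_n at purely imaginary arguments and n >= 1 are meaningful.  An
   element X of V_n, n >= 2, is (u, gamma + s) with u = X.1,
   gamma = scalar_part X.2 and s = cdIm X.2. *)
Fixpoint algC (n : nat) : cd R[i] n -> cd R[i] n -> cd R[i] n :=
  match n with
  | 0 => fun _ _ => 0
  | m.+1 => fun X Y : cd R[i] m * cd R[i] m =>
      if m == 0%N then 0 else
      let u := X.1 in let gamma := scalar_part X.2 in let s := cdIm X.2 in
      let v := Y.1 in let delta := scalar_part Y.2 in let t := cdIm Y.2 in
      let Zp := algC (u + im_unit *: s) (v + im_unit *: t) in
      let Zm := algC (u - im_unit *: s) (v - im_unit *: t) in
      let lambda := dot s v - dot t u in
      let F := 2^-1 *: (Zp + Zm) + gamma *: t - delta *: s in
      let G := cdscal m lambda + delta *: u - gamma *: v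
               + (im_unit / 2) *: (Zp - Zm) in
      (F, G)
  end.

Definition algR (n : nat) : cd R n -> cd R n -> cd R n :=
  match n with
  | 0 => fun _ _ => 0
  | m.+1 => fun X Y : cd R m * cd R m =>
      if m == 0%N then 0 else
      let u := X.1 in let gamma := scalar_part X.2 in let s := cdIm X.2 in
      let v := Y.1 in let delta := scalar_part Y.2 in let t := cdIm Y.2 in
      let Z := algC (cplx u s) (cplx v t) in
      let lambda := dot s v - dot t u in
      let F := cdRec Z + gamma *: t - delta *: s in
      let G := cdscal m lambda + delta *: u - gamma *: v - cdImc Z in
      (F, G)
  end.

Definition algM (n : nat) : cd R n -> cd R n -> cd R n :=
  match n with
  | 0 => fun x y => (x : R) * (y : R)
  | m.+1 => fun x y : cd R m.+1 =>
      let alpha := scalar_part x in let X := cdIm x in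
      let beta := scalar_part y in let Y := cdIm y in
      let Z := algR X Y in
      cdscal m.+1 (alpha * beta - dot X Y) + alpha *: Y + beta *: X + Z
  end.

(** * Call trees of the algorithms *)

Inductive alg := AlgM | AlgR | AlgC.

(* CallNode a n x y z t: algorithm a at level n, called on operands stored as
   x and y, returned z after making the calls t, in chronological order. *)
Inductive calltree :=
  CallNode of alg & nat & seq R & seq R & seq R & seq calltree.

(* Storage format of a complexified element: the real parts of all the
   coordinates, followed by their imaginary parts.  Elements of V_n are stored
   with all their 2 ^ n coordinates as elements of A_n, the first one being 0. *)
Definition ccoeffs (n : nat) (X : cd R[i] n) : seq R :=
  coeffs (cdRec X) ++ coeffs (cdImc X).

Definition operand_size (a : alg) (n : nat) : nat :=
  if a is AlgC then (2 * 2 ^ n)%N else (2 ^ n)%N.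

Fixpoint treeC (n : nat) : cd R[i] n -> cd R[i] n -> calltree :=
  match n with
  | 0 => fun X Y =>
      CallNode AlgC 0 (ccoeffs X) (ccoeffs Y) (ccoeffs (algC X Y)) [::]
  | m.+1 => fun X Y : cd R[i] m * cd R[i] m =>
      CallNode AlgC m.+1 (@ccoeffs m.+1 X) (@ccoeffs m.+1 Y)
        (ccoeffs (@algC m.+1 X Y))
        (if m == 0%N then [::] else
         let u := X.1 in let s := cdIm X.2 in
         let v := Y.1 in let t := cdIm Y.2 in
         [:: treeC (u + im_unit *: s) (v + im_unit *: t);
             treeC (u - im_unit *: s) (v - im_unit *: t)])
  end.

Definition treeR (n : nat) : cd R n -> cd R n -> calltree :=
  match n with
  | 0 => fun X Y =>
      CallNode AlgR 0 (coeffs X) (coeffs Y) (coeffs (algR X Y)) [::]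
  | m.+1 => fun X Y : cd R m * cd R m =>
      CallNode AlgR m.+1 (@coeffs R m.+1 X) (@coeffs R m.+1 Y)
        (coeffs (@algR m.+1 X Y))
        (if m == 0%N then [::] else
         [:: treeC (cplx X.1 (cdIm X.2)) (cplx Y.1 (cdIm Y.2))])
  end.

Definition treeM (n : nat) (x y : cd R n) : calltree :=
  CallNode AlgM n (coeffs x) (coeffs y) (coeffs (algM x y))
    (if n == 0%N then [::] else [:: treeR (cdIm x) (cdIm y)]).

(** * Sequential programs over a real memory *)

(* Index expressions, over the natural-number index variables of the current
   procedure activation (ISub is truncated). *)
Inductive iexp :=
  | IVar of nat
  | INat of nat
  | IAdd of iexp & iexp
  | ISub of iexp & iexp
  | IPow2 of iexp.

Fixpoint ieval (env : seq nat) (e : iexp) : nat :=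
  match e with
  | IVar k => nth 0%N env k
  | INat k => k
  | IAdd e1 e2 => (ieval env e1 + ieval env e2)%N
  | ISub e1 e2 => (ieval env e1 - ieval env e2)%N
  | IPow2 e1 => (2 ^ ieval env e1)%N
  end.

Inductive arith := Add | Sub | Mul.

Definition arith_eval (o : arith) (a b : R) : R :=
  match o with Add => a + b | Sub => a - b | Mul => a * b end.

(* For e c runs c for i = 0, ..., e - 1, appending i to the index variables;
   IfLe e1 e2 c1 c2 runs c1 if e1 <= e2 and c2 otherwise; Call a n x y z w runs
   the body of procedure a with index variables 0, ..., 4 equal to the level,
   the addresses of the two operands, that of the result and that of the
   workspace.  Control depends on the indices only, never on real data. *)
Inductive cmd :=
  | Skip
  | Seq of cmd & cmd
  | Const of iexp & R
  | Copy of iexp & iexp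
  | Arith of arith & iexp & iexp & iexp
  | Scale of iexp & R & iexp
  | For of iexp & cmd
  | IfLe of iexp & iexp & cmd & cmd
  | Call of alg & iexp & iexp & iexp & iexp & iexp.

(* A program is a finite text: the bodies of the procedures M, R and C.  It
   does not depend on the level n, and the index variables of an activation are
   its five parameters and its loop counters, so that a multiplication table or
   a dense matrix could only be held in the real memory. *)
Definition program := alg -> cmd.

Definition slice (m : seq R) (a l : nat) : seq R := take l (drop a m).

(* exec P env c m m' k p t: from memory m, command c terminates with memory m',
   after k real arithmetic operations, p of which are products of two stored
   reals, and the procedure calls t.  There is no rule for an access outside
   the memory, whose size is constant: the size of m is the total real
   storage. *)
Inductive exec (P : program) (env : seq nat) :
    cmd -> seq R -> seq R -> nat -> nat -> seq calltree -> Prop :=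
  | ESkip m : exec P env Skip m m 0 0 [::]
  | ESeq c1 c2 m1 m2 m3 k1 k2 p1 p2 t1 t2 :
      exec P env c1 m1 m2 k1 p1 t1 -> exec P env c2 m2 m3 k2 p2 t2 ->
      exec P env (Seq c1 c2) m1 m3 (k1 + k2) (p1 + p2) (t1 ++ t2)
  | EConst e r m :
      (ieval env e < size m)%N ->
      exec P env (Const e r) m (set_nth 0 m (ieval env e) r) 0 0 [::]
  | ECopy e e1 m :
      (ieval env e < size m)%N -> (ieval env e1 < size m)%N ->
      exec P env (Copy e e1) m
        (set_nth 0 m (ieval env e) m`_(ieval env e1)) 0 0 [::]
  | EArith o e e1 e2 m :
      (ieval env e < size m)%N -> (ieval env e1 < size m)%N ->
      (ieval env e2 < size m)%N ->
      exec P env (Arith o e e1 e2) m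
        (set_nth 0 m (ieval env e)
          (arith_eval o m`_(ieval env e1) m`_(ieval env e2)))
        1 (if o is Mul then 1 else 0) [::]
  | EScale e r e1 m :
      (ieval env e < size m)%N -> (ieval env e1 < size m)%N ->
      exec P env (Scale e r e1) m
        (set_nth 0 m (ieval env e) (r * m`_(ieval env e1))) 1 0 [::]
  | EFor e c m m' k p t :
      exec_loop P env c (ieval env e) m m' k p t ->
      exec P env (For e c) m m' k p t
  | EIfLe e1 e2 c1 c2 m m' k p t :
      exec P env (if (ieval env e1 <= ieval env e2)%N then c1 else c2)
        m m' k p t ->
      exec P env (IfLe e1 e2 c1 c2) m m' k p t
  | ECall a en ex ey ez ew m m' k p t :
      let n := ieval env en in
      let x := ieval env ex in
      let y := ieval env ey in
      let z := ieval env ez in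
      let w := ieval env ew in
      let l := operand_size a n in
      exec P [:: n; x; y; z; w] (P a) m m' k p t ->
      exec P env (Call a en ex ey ez ew) m m' k p
        [:: CallNode a n (slice m x l) (slice m y l) (slice m' z l) t]
with exec_loop (P : program) (env : seq nat) :
    cmd -> nat -> seq R -> seq R -> nat -> nat -> seq calltree -> Prop :=
  | ELoop0 c m : exec_loop P env c 0 m m 0 0 [::]
  | ELoopS c i m1 m2 m3 k1 k2 p1 p2 t1 t2 :
      exec_loop P env c i m1 m2 k1 p1 t1 ->
      exec P (rcons env i) c m2 m3 k2 p2 t2 ->
      exec_loop P env c i.+1 m1 m3 (k1 + k2) (p1 + p2) (t1 ++ t2).

(* With N = 2 ^ n, the memory holds x, y, the output area (initially z0) and aux
   auxiliary reals (initially w0), both with arbitrary initial contents.  The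
   program leaves the inputs unchanged and the product in the output area, and
   its calls are those of M_n.  The bound on p expresses the evaluation rule for
   complex scalar products: with three real products for each of them, M_n uses
   exactly mul_length n products of two data-dependent reals. *)
Definition implements_M (P : program) (n aux ops : nat) : Prop :=
  forall (x y : cd R n) (z0 w0 : seq R), size z0 = (2 ^ n)%N -> size w0 = aux ->
  exists (w1 : seq R) (k p : nat),
    [/\ exec P [::]
          (Call AlgM (INat n) (INat 0) (INat (2 ^ n)) (INat (2 * 2 ^ n))
             (INat (3 * 2 ^ n)))
          (coeffs x ++ coeffs y ++ z0 ++ w0)
          (coeffs x ++ coeffs y ++ coeffs (cdmul x y) ++ w1)
          k p [:: treeM x y],
        (k <= ops)%N
      & p%:Z <= mul_length n].

End Algorithms.

(* Main.v *)
From HB Require Import structures.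
Require Import Defs.
From mathcomp Require Import all_boot all_order all_algebra.
From mathcomp Require Import reals complex.
From mathcomp Require Import ring lra zify.

(** For imaginary x and y, the product x y is -<x, y> plus an imaginary element
    [x, y], a cross product that is bilinear and antisymmetric because
    x conj(y) + y conj(x) = 2 <x, y> (conj_polarization).  For X = (u, g + s) and
    Y = (v, d + t), with g and d scalars, the doubling formula becomes
    (cross_split)
      [X, Y] = ([u, v] - [s, t] + g t - d s,
                <s, v> - <t, u> + d u - g v - ([u, t] + [s, v])),
    which asks for four cross products one level below.  The two combinations
    needed are the real and imaginary parts of
      [u + i s, v + i t] = ([u, v] - [s, t]) + i ([u, t] + [s, v]),
    so over the reals one complexified cross product is enough.  Over the
    complex numbers i is already a scalar, and the same two combinations are
    half the sum and half the difference of the two cross products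
    [u + i s, v + i t] and [u - i s, v - i t].  This proves that C_n and R_n
    compute [X, Y], hence that M_n computes the product (algM_mul).

    Length.  The six terms g t, d s, <s, v>, <t, u>, d u, g v cost one product of
    scalars for each of the 2^m - 1 imaginary coordinates at level m
    (bilin_cross_rest).  The number c_n of complex products in C_n thus satisfies
    c_(m+1) = 2 c_m + 6 (2^m - 1), that is c_n = (3 n - 6) 2^n + 6 for n >= 1.
    A complex product costs three real ones (bilin_realify), so R_n costs
    3 c_(n-1) + 6 (2^(n-1) - 1) real products for n >= 2, and M_n adds one for
    the real parts and 3 (2^n - 1) for <X, Y>, alpha Y and beta X.  The total is
    exactly (9 n - 15) 2^(n-1) + 10 (mul_lengthE).

    Implementation.  At each level, the operands of the recursive calls are built
    in two buffers of the workspace, which the two calls of C_n use one after the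
    other; the workspaces of successive levels form a geometric series, of total
    size O(2^n).  Every level does O(2^n) operations in all its calls together,
    hence O(n 2^n) operations.  The two results of the recursive calls are
    returned in the two halves of the output area, where they are combined in
    place; the six remaining terms are then added to the output by a loop of
    multiply-add instructions, which performs exactly the products counted above.

    To verify the program, memories are functions on addresses: an interpreter
    (run) gives the effect of code without calls, and its safety and its costs
    depend on the index variables only (exec_run).  A loop of multiply-adds is
    specified by the family of values that it adds to the output (adds), so that
    the effect of the loop is a finite sum, identified with the coordinates of
    the six terms by cross_rest_sum.  The three procedures then satisfy exec_C,
    exec_R and exec_M. *)

Import Order.TTheory GRing.Theory Num.Theory.
Set Implicit Arguments.
Unset Strict Implicit.
Unset Printing Implicit Defensive.
Local Open Scope ring_scope.
Arguments cdmul : simpl never.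
Arguments cdconj : simpl never.
Arguments cdscal : simpl never.
Arguments algC : simpl never.
Arguments algR : simpl never.
Arguments algM : simpl never.

(** * Coordinates, product and cross product in the tower *)

Section Coordinates.
Variable K : fieldType.

(** Coordinates are total in the index: an identity between linear expressions
    in the tower is proved by cf_inj and ring, coordinate by coordinate. *)
Definition cf (n : nat) (x : cd K n) (i : nat) : K := (coeffs x)`_i.

Lemma size_coeffs n (x : cd K n) : size (coeffs x) = (2 ^ n)%N.
Proof.
elim: n x => [|m IH] //= [a b]; rewrite size_cat !IH expnS; lia.
Qed.

Lemma cf_pair m (x : cd K m.+1) i :
  cf x i = if (i < 2 ^ m)%N then cf x.1 i else cf x.2 (i - 2 ^ m).
Proof. by rewrite /cf /= nth_cat size_coeffs. Qed.

Lemma cf_oversize n (x : cd K n) i : (2 ^ n <= i)%N -> cf x i = 0.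
Proof. by move=> h; rewrite /cf nth_default ?size_coeffs. Qed.

Lemma cf_fst m (x : cd K m.+1) i : (i < 2 ^ m)%N -> cf x i = cf x.1 i.
Proof. by rewrite cf_pair => ->. Qed.

Lemma cf_snd m (x : cd K m.+1) i : cf x (2 ^ m + i) = cf x.2 i.
Proof. by rewrite cf_pair ltnNge leq_addr addKn. Qed.

Lemma cf_inj n (x y : cd K n) : (forall i, cf x i = cf y i) -> x = y.
Proof.
elim: n x y => [|m IH] x y h; first exact: (h 0%N).
rewrite [x]surjective_pairing [y]surjective_pairing; congr (_, _); apply: IH => i.
  case: (ltnP i (2 ^ m)) => him; first by rewrite -!cf_fst.
  by rewrite !cf_oversize.
by rewrite -!cf_snd.
Qed.

Lemma cfD n (x y : cd K n) i : cf (x + y) i = cf x i + cf y i.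
Proof.
elim: n x y i => [|m IH] x y i; last by rewrite !cf_pair /= !IH; case: ifP.
by case: i => [|i] //; rewrite /cf /= !nth_nil addr0.
Qed.

Lemma cfZ n (a : K) (x : cd K n) i : cf (a *: x) i = a * cf x i.
Proof.
elim: n x i => [|m IH] x i; last by rewrite !cf_pair /= !IH; case: ifP.
by case: i => [|i] //; rewrite /cf /= !nth_nil mulr0.
Qed.

Lemma cf0 n i : cf (0 : cd K n) i = 0.
Proof. by rewrite -(scale0r (0 : cd K n)) cfZ mul0r. Qed.

Lemma cfN n (x : cd K n) i : cf (- x) i = - cf x i.
Proof. by rewrite -scaleN1r cfZ mulN1r. Qed.

Lemma cf_scal n c i : cf (cdscal n c : cd K n) i = if i == 0%N then c else 0.
Proof.
elim: n i => [|m IH] i; first by case: i => [|i]; rewrite /cf //= nth_nil.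
rewrite cf_pair /= IH cf0; case: eqP => [->|_]; last by case: ifP.
by rewrite expn_gt0.
Qed.

Lemma cf_conj n (x : cd K n) i : cf (cdconj x) i = if i == 0%N then cf x i else - cf x i.
Proof.
elim: n x i => [|m IH] x i.
  by case: i => [|i]; rewrite /cf //= nth_nil oppr0.
rewrite !cf_pair /= IH cfN; case: eqP => [->|_]; last by case: ifP.
by rewrite expn_gt0.
Qed.

Lemma cf_sum n I r (F : I -> cd K n) i :
  cf (\sum_(k <- r) F k) i = \sum_(k <- r) cf (F k) i.
Proof.
by elim: r => [|a r IH]; rewrite ?big_nil ?cf0 // !big_cons cfD IH.
Qed.

Lemma dotE n (x y : cd K n) : dot x y = \sum_(j < 2 ^ n) cf x j * cf y j.
Proof. by []. Qed.

Lemma dot_pair m (x y : cd K m.+1) : dot x y = dot x.1 y.1 + dot x.2 y.2.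
Proof.
have e : (2 ^ m.+1 = 2 ^ m + 2 ^ m)%N by rewrite expnS; lia.
rewrite !dotE e big_split_ord /=; congr (_ + _); apply: eq_bigr => i _.
  by rewrite !cf_fst.
by rewrite !cf_snd.
Qed.

Lemma dotC n (x y : cd K n) : dot x y = dot y x.
Proof. by rewrite !dotE; apply: eq_bigr => i _; rewrite mulrC. Qed.

Lemma dotDl n (x y z : cd K n) : dot (x + y) z = dot x z + dot y z.
Proof.
by rewrite !dotE -big_split; apply: eq_bigr => i _; rewrite cfD mulrDl.
Qed.

Lemma dotZl n a (x y : cd K n) : dot (a *: x) y = a * dot x y.
Proof. by rewrite !dotE mulr_sumr; apply: eq_bigr => i _; rewrite cfZ mulrA. Qed.

Lemma dotDr n (x y z : cd K n) : dot x (y + z) = dot x y + dot x z.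
Proof. by rewrite dotC dotDl ![dot _ x]dotC. Qed.

Lemma dotZr n a (x y : cd K n) : dot x (a *: y) = a * dot x y.
Proof. by rewrite dotC dotZl dotC. Qed.

Fixpoint mkcd (n : nat) (f : nat -> K) : cd K n :=
  match n with
  | 0 => f 0%N
  | m.+1 => (mkcd m f, mkcd m (fun i => f (2 ^ m + i)%N))
  end.

Lemma cf_mk n f i : (i < 2 ^ n)%N -> cf (mkcd n f) i = f i.
Proof.
elim: n f i => [|m IH] f i hi; first by case: i hi.
rewrite cf_pair /=; case: ltnP => him; first exact: IH.
rewrite IH; last by rewrite expnS in hi; lia.
by rewrite subnKC.
Qed.

Lemma cdmulS m (x y : cd K m.+1) : cdmul x y =
  (cdmul x.1 y.1 - cdmul (cdconj y.2) x.2, cdmul y.2 x.1 + cdmul x.2 (cdconj y.1)).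
Proof. by []. Qed.

Lemma conjS m (x : cd K m.+1) : cdconj x = (cdconj x.1, - x.2).
Proof. by []. Qed.

Lemma conjK n (x : cd K n) : cdconj (cdconj x) = x.
Proof. by apply: cf_inj => i; rewrite !cf_conj; case: eqP; rewrite ?opprK. Qed.

Lemma conjD n (x y : cd K n) : cdconj (x + y) = cdconj x + cdconj y.
Proof. by apply: cf_inj => i; rewrite !(cf_conj, cfD) opprD; case: ifP. Qed.

Lemma conjZ n a (x : cd K n) : cdconj (a *: x) = a *: cdconj x.
Proof. by apply: cf_inj => i; rewrite !(cf_conj, cfZ); case: ifP; rewrite ?mulrN. Qed.

Lemma conjN n (x : cd K n) : cdconj (- x) = - cdconj x.
Proof. by rewrite -scaleN1r conjZ scaleN1r. Qed.

Lemma conj_scal n c : cdconj (cdscal n c : cd K n) = cdscal n c.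
Proof. by apply: cf_inj => i; rewrite cf_conj cf_scal; case: eqP; rewrite ?oppr0. Qed.

(** Left and right additivity at one level both use the two of them at the level
    below, since the doubling formula exchanges the order of factors. *)
Lemma cdmulDlr n (x y z : cd K n) :
  cdmul (x + y) z = cdmul x z + cdmul y z /\
  cdmul z (x + y) = cdmul z x + cdmul z y.
Proof.
elim: n x y z => [|m IH] x y z; first by rewrite /cdmul mulrDl mulrDr.
have dl a b c : cdmul (a + b : cd K m) c = cdmul a c + cdmul b c := (IH a b c).1.
have dr c a b : cdmul c (a + b : cd K m) = cdmul c a + cdmul c b := (IH a b c).2.
by split; rewrite !cdmulS; congr (_, _); rewrite /= ?conjD ?(dl, dr) ?opprD addrACA.
Qed.

Lemma cdmulDl n (x y z : cd K n) : cdmul (x + y) z = cdmul x z + cdmul y z.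
Proof. by case: (cdmulDlr x y z). Qed.

Lemma cdmulDr n (z x y : cd K n) : cdmul z (x + y) = cdmul z x + cdmul z y.
Proof. by case: (cdmulDlr x y z). Qed.

Lemma cdmulZlr n a (x z : cd K n) :
  cdmul (a *: x) z = a *: cdmul x z /\ cdmul z (a *: x) = a *: cdmul z x.
Proof.
elim: n x z => [|m IH] x z.
  by split; [exact: esym (@mulrA K _ _ _) | exact: (@mulrCA K)].
have zl b c : cdmul (a *: b : cd K m) c = a *: cdmul b c := (IH b c).1.
have zr c b : cdmul c (a *: b : cd K m) = a *: cdmul c b := (IH b c).2.
by split; rewrite !cdmulS; congr (_, _); rewrite /= ?conjZ ?(zl, zr) -?scalerN -scalerDr.
Qed.

Lemma cdmulZl n a (x z : cd K n) : cdmul (a *: x) z = a *: cdmul x z.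
Proof. by case: (cdmulZlr a x z). Qed.

Lemma cdmulZr n a (x z : cd K n) : cdmul x (a *: z) = a *: cdmul x z.
Proof. by case: (cdmulZlr a z x). Qed.

Lemma cdmulNl n (x z : cd K n) : cdmul (- x) z = - cdmul x z.
Proof. by rewrite -scaleN1r cdmulZl scaleN1r. Qed.

Lemma cdmulNr n (x z : cd K n) : cdmul x (- z) = - cdmul x z.
Proof. by rewrite -scaleN1r cdmulZr scaleN1r. Qed.

Lemma cdmul0l n (x : cd K n) : cdmul 0 x = 0.
Proof. by rewrite -(scale0r (0 : cd K n)) cdmulZl !scale0r. Qed.

Lemma cdmul0r n (x : cd K n) : cdmul x 0 = 0.
Proof. by rewrite -(scale0r (0 : cd K n)) cdmulZr !scale0r. Qed.

Lemma cdmul_scal n c (x : cd K n) :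
  cdmul (cdscal n c) x = c *: x /\ cdmul x (cdscal n c) = c *: x.
Proof.
elim: n x => [|m IH] x; first by split=> //; exact: (@mulrC K).
have sl (y : cd K m) : cdmul (cdscal m c) y = c *: y := (IH y).1.
have sr (y : cd K m) : cdmul y (cdscal m c) = c *: y := (IH y).2.
have c0 : cdconj (0 : cd K m) = 0.
  by rewrite -(scale0r (0 : cd K m)) conjZ !scale0r.
by split; rewrite [RHS]surjective_pairing cdmulS /= ?conj_scal ?sl ?sr ?c0 ?cdmul0l ?cdmul0r
  ?subr0 ?addr0 ?add0r.
Qed.

Lemma cdmul_scall n c (x : cd K n) : cdmul (cdscal n c) x = c *: x.
Proof. by case: (cdmul_scal c x). Qed.

Lemma cdmul_scalr n c (x : cd K n) : cdmul x (cdscal n c) = c *: x.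
Proof. by case: (cdmul_scal c x). Qed.

(** The two polarization identities are proved together because the doubling
    formula mixes products with a conjugate on the left and on the right. *)
Lemma conj_polarization n (x y : cd K n) :
  cdmul x (cdconj y) + cdmul y (cdconj x) = cdscal n (2 * dot x y) /\
  cdmul (cdconj x) y + cdmul (cdconj y) x = cdscal n (2 * dot x y).
Proof.
elim: n x y => [|m IH] x y.
  have h (a b : K) : a * b + b * a = 2 * (a * b) by ring.
  by rewrite dotE big_ord1; split; exact: h.
have pr (a b : cd K m) := (IH a b).1; have pl (a b : cd K m) := (IH a b).2.
have e : cdscal m (2 * dot x y) = cdscal m (2 * dot x.1 y.1) + cdscal m (2 * dot x.2 y.2).
  by apply: cf_inj => i; rewrite cfD !cf_scal dot_pair; case: ifP => _; ring.
have c2 (a b c d : cd K m) : a + b + (c + d) = (a + c) + (b + d) by rewrite addrACA.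
split; rewrite !conjS !cdmulS; congr (_, _);
  rewrite /= ?e ?(conjK, conjN) ?conjN !(cdmulNl, cdmulNr, opprK).
- by rewrite c2 pr [X in _ + X]addrC pl.
- by apply: cf_inj => i; rewrite !(cfD, cfN, cf0); ring.
- by rewrite c2 pl [X in _ + X]addrC pl.
- by apply: cf_inj => i; rewrite !(cfD, cfN, cf0); ring.
Qed.

(** The imaginary part of the product of imaginary elements; on other arguments
    it is only a bilinear extension. *)
Definition cross n (x y : cd K n) : cd K n := cdmul x y + cdscal n (dot x y).

(** Equivalent to cdconj x = - x when 2 is invertible, but stable under linear
    combinations by computation on the first coordinate alone. *)
Definition imag n (x : cd K n) := cf x 0 = 0.

Hypothesis two_neq0 : (2 : K) != 0.

Lemma cf_Im n (x : cd K n) i : cf (cdIm x) i = if i == 0%N then 0 else cf x i.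
Proof.
rewrite /cdIm cfZ cfD cfN cf_conj; case: eqP => _; first by rewrite subrr mulr0.
by field.
Qed.

Lemma scalar_partE n (x : cd K n) : scalar_part x = cf x 0.
Proof.
by rewrite -[scalar_part x]/(cf (cdRe x) 0) /cdRe cfZ cfD cf_conj /=; field.
Qed.

Lemma imag_conj n (x : cd K n) : imag x -> cdconj x = - x.
Proof.
move=> h; apply: cf_inj => i; rewrite cf_conj cfN.
by case: eqP => [->|//]; rewrite h oppr0.
Qed.

Lemma imag_Im n (x : cd K n) : imag (cdIm x).
Proof. by rewrite /imag cf_Im. Qed.

Lemma Im_linear n : linear (@cdIm K n).
Proof.
move=> a x y; apply: cf_inj => i.
by rewrite cf_Im [RHS]cfD [cf (a *: cdIm x) i]cfZ !cf_Im cfD cfZ; case: ifP => _; ring.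
Qed.

Lemma eq_Im n (x : cd K n) : x = cdscal n (cf x 0) + cdIm x.
Proof.
apply: cf_inj => i; rewrite cfD cf_scal cf_Im.
by case: eqP => [->|_]; rewrite ?addr0 ?add0r.
Qed.

Lemma imagD n (x y : cd K n) : imag x -> imag y -> imag (x + y).
Proof. by rewrite /imag cfD => -> ->; rewrite addr0. Qed.

Lemma imagZ n a (x : cd K n) : imag x -> imag (a *: x).
Proof. by rewrite /imag cfZ => ->; rewrite mulr0. Qed.

Lemma imag_fst m (x : cd K m.+1) : imag x -> imag x.1.
Proof. by rewrite /imag cf_pair expn_gt0. Qed.

Lemma crossDl n (x y z : cd K n) : cross (x + y) z = cross x z + cross y z.
Proof.
by apply: cf_inj => i; rewrite /cross cdmulDl dotDl !cfD !cf_scal; case: ifP => _; ring.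
Qed.

Lemma crossDr n (z x y : cd K n) : cross z (x + y) = cross z x + cross z y.
Proof.
by apply: cf_inj => i; rewrite /cross cdmulDr dotDr !cfD !cf_scal; case: ifP => _; ring.
Qed.

Lemma crossZl n a (x y : cd K n) : cross (a *: x) y = a *: cross x y.
Proof.
apply: cf_inj => i; rewrite /cross cdmulZl dotZl !(cfD, cfZ) !cf_scal.
by case: ifP => _; ring.
Qed.

Lemma crossZr n a (x y : cd K n) : cross x (a *: y) = a *: cross x y.
Proof.
apply: cf_inj => i; rewrite /cross cdmulZr dotZr !(cfD, cfZ) !cf_scal.
by case: ifP => _; ring.
Qed.

Lemma cross_anti n (x y : cd K n) : imag x -> imag y -> cross y x = - cross x y.
Proof.
move=> hx hy; have [h _] := conj_polarization x y; apply: cf_inj => i.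
move: h; rewrite !imag_conj // !cdmulNr => /(congr1 (fun z => cf z i)).
rewrite /cross !(cfN, cfD, cf_scal) [dot y x]dotC => h.
suff e : cf (cdmul y x) i = - cf (cdmul x y) i - (if i == 0%N then 2 * dot x y else 0).
  by rewrite e; case: ifP => _; ring.
by rewrite -h; ring.
Qed.

(** Expanding the doubling formula leaves products t s and t u in the wrong order;
    antisymmetry of the cross product turns them around. *)
Lemma cross_split m (x y : cd K m.+1) (g d : K) (s t : cd K m) :
    imag x.1 -> imag y.1 -> imag s -> imag t ->
    x.2 = cdscal m g + s -> y.2 = cdscal m d + t ->
  cross x y =
  (cross x.1 y.1 - cross s t + g *: t - d *: s,
   cdscal m (dot s y.1 - dot t x.1) + d *: x.1 - g *: y.1
     - (cross x.1 t + cross s y.1)).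
Proof.
case: x y => u x2 [v y2] /= hu hv hs ht -> ->.
have a1 := cross_anti hs ht; have a2 := cross_anti hu ht.
have dgt : dot (cdscal m g) t = 0.
  rewrite dotE big1 // => j _; rewrite cf_scal.
  by case: eqP => [->|_]; rewrite ?ht ?mulr0 ?mul0r.
have dds : dot s (cdscal m d) = 0.
  rewrite dotE big1 // => j _; rewrite cf_scal.
  by case: eqP => [->|_]; rewrite ?hs ?mulr0 ?mul0r.
have dgd : dot (cdscal m g) (cdscal m d) = g * d.
  rewrite dotE (bigD1 (Ordinal (expn_gt0 2 m : 0 < 2 ^ m)%N)) //= !cf_scal eqxx.
  rewrite big1 ?addr0 // => j; rewrite -val_eqE /= !cf_scal => /negPf ->.
  by rewrite mulr0.
have dd : dot (cdscal m g + s) (cdscal m d + t) = g * d + dot s t.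
  by rewrite dotDl !dotDr dgt dds dgd addr0 add0r.
have es : cdmul t s = - cdmul s t - cdscal m (2 * dot s t).
  apply: cf_inj => i; move/(congr1 (fun z => cf z i)): a1.
  rewrite /cross !(cfN, cfD, cf_scal) [dot t s]dotC => h.
  by rewrite -[LHS](addrK (if i == 0%N then dot s t else 0)) h; case: ifP => _; ring.
have eu : cdmul t u = - cdmul u t - cdscal m (2 * dot u t).
  apply: cf_inj => i; move/(congr1 (fun z => cf z i)): a2.
  rewrite /cross !(cfN, cfD, cf_scal) [dot t u]dotC => h.
  by rewrite -[LHS](addrK (if i == 0%N then dot u t else 0)) h; case: ifP => _; ring.
rewrite {1}/cross cdmulS dot_pair /= dd conjD conj_scal !imag_conj //.
rewrite !(cdmulDl, cdmulDr, cdmul_scall, cdmul_scalr, cdmulNl, cdmulNr) es eu.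
congr (_, _); apply: cf_inj => i; rewrite /cross !(cfD, cfN, cfZ, cf_scal).
  by case: eqP => _; rewrite ?cf0; ring.
by rewrite ?cf0 [dot t u]dotC; case: eqP => _; ring.
Qed.

Lemma imag_scal_Im m (x : cd K m) : x = cdscal m (scalar_part x) + cdIm x.
Proof. by rewrite scalar_partE -eq_Im. Qed.

End Coordinates.

(** * Extension of scalars *)

Section BaseChange.
Variables K L : fieldType.

Lemma cf_map (f : K -> L) n (x : cd K n) i :
  f 0 = 0 -> cf (cdmap f x) i = f (cf x i).
Proof.
move=> f0; elim: n x i => [|m IH] x i; last by rewrite !cf_pair /= !IH; case: ifP.
by case: i => [|i]; rewrite /cf //= !nth_nil f0.
Qed.

Variable f : {rmorphism K -> L}.

Lemma cdmap_mul n (x y : cd K n) : cdmul (cdmap f x) (cdmap f y) = cdmap f (cdmul x y).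
Proof.
have mD m (a b : cd K m) : cdmap f (a + b) = cdmap f a + cdmap f b.
  by apply: cf_inj => i; rewrite !(cfD, cf_map, rmorph0, rmorphD).
have mN m (a : cd K m) : cdmap f (- a) = - cdmap f a.
  by apply: cf_inj => i; rewrite !(cfN, cf_map, rmorph0, rmorphN).
have mC m (a : cd K m) : cdconj (cdmap f a) = cdmap f (cdconj a).
  apply: cf_inj => i; rewrite !(cf_conj, cf_map, rmorph0) //.
  by case: ifP => _; rewrite ?rmorphN.
elim: n x y => [|m IH] x y; first exact: esym (rmorphM f _ _).
by rewrite !cdmulS /= ?mC ?IH -?mN -?mD.
Qed.

Lemma cdmap_dot n (x y : cd K n) : dot (cdmap f x) (cdmap f y) = f (dot x y).
Proof.
by rewrite !dotE rmorph_sum; apply: eq_bigr => j _; rewrite !cf_map ?rmorph0 ?rmorphM.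
Qed.

Lemma cdmap_cross n (x y : cd K n) :
  cross (cdmap f x) (cdmap f y) = cdmap f (cross x y).
Proof.
rewrite /cross cdmap_mul cdmap_dot; apply: cf_inj => i.
rewrite !(cfD, cf_map, cf_scal, rmorph0, rmorphD) //.
by case: ifP => _; rewrite ?rmorph0.
Qed.

End BaseChange.

(** * The recursive algorithms compute products *)

Section Correctness.
Variable R : realType.
Local Notation C := R[i].

Lemma two_neq0_real : (2 : R) != 0. Proof. by rewrite pnatr_eq0. Qed.
Lemma two_neq0_complex : (2 : C) != 0. Proof. by rewrite pnatr_eq0. Qed.
Let twoR := two_neq0_real.
Let twoC := two_neq0_complex.

Lemma im_unit2 : im_unit R * im_unit R = -1.
Proof. by apply/eqP; rewrite eq_complex /= !mul0r !mulr0 mul1r sub0r addr0 oppr0 !eqxx. Qed.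

Lemma algC_step m (X Y : cd C m.+2) : algC X Y =
  let u : cd C m.+1 := X.1 in let x : cd C m.+1 := X.2 in
  let v : cd C m.+1 := Y.1 in let y : cd C m.+1 := Y.2 in
  let Zp := algC (u + im_unit R *: cdIm x) (v + im_unit R *: cdIm y) in
  let Zm := algC (u - im_unit R *: cdIm x) (v - im_unit R *: cdIm y) in
  (2^-1 *: (Zp + Zm) + scalar_part x *: cdIm y - scalar_part y *: cdIm x,
   cdscal m.+1 (dot (cdIm x) v - dot (cdIm y) u)
     + scalar_part y *: u - scalar_part x *: v + (im_unit R / 2) *: (Zp - Zm)).
Proof. by []. Qed.

(** The sum of the two recursive results is 2 ([u, v] - [s, t]), as the mixed
    terms cancel, and their difference 2 i ([u, t] + [s, v]): the coefficient i / 2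
    supplies the minus sign of the second component of cross_split. *)
Lemma algC_cross n (X Y : cd C n) : imag X -> imag Y -> algC X Y = cross X Y.
Proof.
elim: n X Y => [|m IH] X Y hX hY.
  have z0 (Z : cd C 0) : imag Z -> Z = 0 by [].
  rewrite (z0 X hX) /cross cdmul0l /=; apply: (cf_inj (n := 0)) => i.
  by rewrite cfD !cf0 add0r; case: i => [|i]; rewrite /cf /= ?dotE ?big_ord1 ?cf0 ?mul0r ?nth_nil.
have hu := imag_fst hX; have hv := imag_fst hY.
have hs := imag_Im twoC X.2; have ht := imag_Im twoC Y.2.
rewrite (cross_split hu hv hs ht (imag_scal_Im twoC _) (imag_scal_Im twoC _)).
case: m IH X Y hX hY hu hv hs ht => [|m] IH X Y hX hY hu hv hs ht.
  have z0 (Z : cd C 0) : imag Z -> Z = 0 by [].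
  rewrite (z0 _ hu) (z0 _ hv) (z0 _ hs) (z0 _ ht).
  have c0 : cross (0 : cd C 0) 0 = 0.
    by rewrite -(scale0r (0 : cd C 0)) crossZl !scale0r.
  by rewrite c0 !scaler0 !subrr !addr0 !subr0.
have is_ a : imag a -> imag (im_unit R *: a : cd C m.+1) by exact: imagZ.
have isN a : imag a -> imag (- (im_unit R *: a) : cd C m.+1).
  by rewrite -scaleN1r scalerA => ?; apply/imagZ.
rewrite algC_step /=.
move: (cdIm (X.2 : cd C m.+1)) (cdIm (Y.2 : cd C m.+1)) hs ht => s t hs ht.
rewrite !IH; try by [apply: imagD => //; auto].
rewrite !(crossDl, crossDr) -!scaleNr !(crossZl, crossZr).
move: (X.1 : cd C m.+1) (Y.1 : cd C m.+1) => u v.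
move: (cross u v) (cross u t) (cross s v) (cross s t) => a b c d.
have i2 := im_unit2; move: (im_unit R) i2 => j j2.
have j2' : j ^+ 2 = -1 by [].
by congr (_, _); apply: (@cf_inj _ m.+1) => i; rewrite !(cfD, cfN, cfZ, cf_scal); field: j2'.
Qed.

Lemma cReD (a b : C) : complex.Re (a + b) = complex.Re a + complex.Re b.
Proof. by case: a b => ? ? [? ?]. Qed.

Lemma cImD (a b : C) : complex.Im (a + b) = complex.Im a + complex.Im b.
Proof. by case: a b => ? ? [? ?]. Qed.

Lemma cReN (a : C) : complex.Re (- a) = - complex.Re a.
Proof. by case: a. Qed.

Lemma cImN (a : C) : complex.Im (- a) = - complex.Im a.
Proof. by case: a. Qed.

Lemma cReM (a b : C) :
  complex.Re (a * b) = complex.Re a * complex.Re b - complex.Im a * complex.Im b.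
Proof. by case: a b => ? ? [? ?]. Qed.

Lemma cImM (a b : C) :
  complex.Im (a * b) = complex.Re a * complex.Im b + complex.Im a * complex.Re b.
Proof. by case: a b => ? ? [? ?]. Qed.

Lemma complex_ext (a b : C) :
  complex.Re a = complex.Re b -> complex.Im a = complex.Im b -> a = b.
Proof. by case: a b => ? ? [? ?] /= -> ->. Qed.

Lemma cf_Rec n (X : cd C n) i : cf (cdRec X) i = complex.Re (cf X i).
Proof. exact: cf_map. Qed.

Lemma cf_Imc n (X : cd C n) i : cf (cdImc X) i = complex.Im (cf X i).
Proof. exact: cf_map. Qed.

Lemma cf_cplx n (u s : cd R n) i : cf (cplx u s) i = Complex (cf u i) (cf s i).
Proof.
rewrite /cplx cfD cfZ !cf_map //; apply: complex_ext;
  by rewrite ?(cReD, cImD, cReM, cImM) /im_unit /=; ring.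
Qed.

Lemma cplx_linear n c (u s u' s' : cd R n) :
  cplx (c *: u + u') (c *: s + s') = Complex c 0 *: cplx u s + cplx u' s'.
Proof.
apply: cf_inj => i; rewrite [RHS]cfD (cfZ (Complex c 0)) !cf_cplx !(cfD, cfZ).
by apply: complex_ext; rewrite ?(cReD, cImD, cReM, cImM) /=; ring.
Qed.

Lemma cdRec_linear n c (X Y : cd C n) :
  cdRec (Complex c 0 *: X + Y) = c *: cdRec X + cdRec Y.
Proof.
apply: cf_inj => i; rewrite cf_Rec [RHS]cfD cfD !cfZ !cf_Rec.
by rewrite ?(cReD, cReM) /=; ring.
Qed.

Lemma cdImc_linear n c (X Y : cd C n) :
  cdImc (Complex c 0 *: X + Y) = c *: cdImc X + cdImc Y.
Proof.
apply: cf_inj => i; rewrite cf_Imc [RHS]cfD cfD !cfZ !cf_Imc.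
by rewrite ?(cImD, cImM) /=; ring.
Qed.

Lemma cplx_imag n (u s : cd R n) : imag u -> imag s -> imag (cplx u s).
Proof. by rewrite /imag cf_cplx => -> ->. Qed.

(** Multiplication of the formal complex numbers u + i s and v + i t, with the
    real cross product in place of the product. *)
Lemma cross_cplx n (u s v t : cd R n) :
  cross (cplx u s) (cplx v t) =
  cplx (cross u v - cross s t) (cross u t + cross s v).
Proof.
have ce (a b : cd R n) :
    cplx a b = cdmap (real_complex R) a + im_unit R *: cdmap (real_complex R) b by [].
rewrite !ce !(crossDl, crossDr) !(crossZl, crossZr) !cdmap_cross -ce.
move: (cross u v) (cross u t) (cross s v) (cross s t) => a b c d.
apply: cf_inj => i; rewrite cf_cplx !(cfD, cfZ, cfN) !cf_map //.
by apply: complex_ext; rewrite ?(cReD, cImD, cReM, cImM) /im_unit /=; ring.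
Qed.

Lemma algR_step m (X Y : cd R m.+2) : algR X Y =
  let u : cd R m.+1 := X.1 in let x : cd R m.+1 := X.2 in
  let v : cd R m.+1 := Y.1 in let y : cd R m.+1 := Y.2 in
  let Z := algC (cplx u (cdIm x)) (cplx v (cdIm y)) in
  (cdRec Z + scalar_part x *: cdIm y - scalar_part y *: cdIm x,
   cdscal m.+1 (dot (cdIm x) v - dot (cdIm y) u)
     + scalar_part y *: u - scalar_part x *: v - cdImc Z).
Proof. by []. Qed.

(** The imaginary elements at level 1 form a line. *)
Lemma cross1 (K : fieldType) (X Y : cd K 1) : imag X -> imag Y -> cross X Y = 0.
Proof.
case: X Y => [u s] [v t] /= hu hv.
rewrite /imag /cf /= in hu hv; rewrite /cross cdmulS dot_pair /= !dotE !big_ord1 /cf /=.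
rewrite hu hv; congr (_, _); rewrite /cdmul /cdconj /cdscal /=.
  by apply: (@cf_inj _ 0) => -[|i]; rewrite /cf /= ?nth_nil //; ring.
by apply: (@cf_inj _ 0) => -[|i]; rewrite /cf /= ?nth_nil //; ring.
Qed.

Lemma algR_cross n (X Y : cd R n) : (0 < n)%N -> imag X -> imag Y ->
  algR X Y = cross X Y.
Proof.
case: n X Y => [//|[|m]] X Y _ hX hY; first by rewrite cross1.
have hu := imag_fst hX; have hv := imag_fst hY.
have hs := imag_Im twoR (X.2 : cd R m.+1).
have ht := imag_Im twoR (Y.2 : cd R m.+1).
rewrite (cross_split hu hv hs ht (imag_scal_Im twoR (X.2 : cd R m.+1))
  (imag_scal_Im twoR (Y.2 : cd R m.+1))).
rewrite algR_step /=.
move: (cdIm (X.2 : cd R m.+1)) (cdIm (Y.2 : cd R m.+1)) hs ht => s t hs ht.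
rewrite algC_cross ?cross_cplx; try exact: cplx_imag.
move: (X.1 : cd R m.+1) (Y.1 : cd R m.+1) => u v.
move: (cross u v) (cross u t) (cross s v) (cross s t) => a b c d.
have -> p q : cdRec (cplx p q) = p :> cd R m.+1.
  by apply: cf_inj => i; rewrite cf_Rec cf_cplx.
have -> p q : cdImc (cplx p q) = q :> cd R m.+1.
  by apply: cf_inj => i; rewrite cf_Imc cf_cplx.
by [].
Qed.

Lemma algM_mul n (x y : cd R n) : algM x y = cdmul x y.
Proof.
case: n x y => [//|n] x y.
have -> : algM x y = cdscal n.+1 (scalar_part x * scalar_part y - dot (cdIm x) (cdIm y))
   + scalar_part x *: cdIm y + scalar_part y *: cdIm x + algR (cdIm x) (cdIm y) by [].
rewrite algR_cross //; try exact: (imag_Im twoR).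
transitivity
  (cdmul (cdscal n.+1 (scalar_part x) + cdIm x) (cdscal n.+1 (scalar_part y) + cdIm y));
  last by rewrite -!imag_scal_Im.
move: (cdIm x) (cdIm y) (scalar_part x) (scalar_part y) => X Y a b.
rewrite !(cdmulDl, cdmulDr) !(cdmul_scall, cdmul_scalr) /cross.
by apply: cf_inj => i; rewrite !(cfD, cfZ, cf_scal); case: ifP => _; ring.
Qed.

End Correctness.

(** * Bilinear algorithms and their lengths *)

(** Building an algorithm one product at a time makes sums, compositions and
    restriction of scalars inductions on the derivation. *)
Inductive bilin_alg (K : fieldType) (U V W : vectType K) : (U -> V -> W) -> nat -> Prop :=
  | BilinNil mu : (forall x y, mu x y = 0) -> bilin_alg mu 0
  | BilinCons mu mu' r (alpha : U -> K^o) (beta : V -> K^o) (w : W) :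
      linear alpha -> linear beta -> bilin_alg mu r ->
      (forall x y, mu' x y = ((alpha x : K) * beta y) *: w + mu x y) ->
      bilin_alg mu' r.+1.

Section BilinearAlgorithms.
Variable K : fieldType.

Section Closure.
Variables U V W : vectType K.
Implicit Types mu nu : U -> V -> W.

Lemma bilin_ext mu nu r : (forall x y, nu x y = mu x y) -> bilin_alg mu r -> bilin_alg nu r.
Proof.
move=> e h; case: h e => [m0 h0|m0 m1 r0 a b w la lb h0 h1] e.
  by apply: BilinNil => x y; rewrite e.
by apply: (BilinCons la lb h0) => x y; rewrite e.
Qed.

Lemma bilin_add mu nu r s : bilin_alg mu r -> bilin_alg nu s ->
  bilin_alg (fun x y => mu x y + nu x y) (r + s).
Proof.
move=> h hn; elim: h => {mu r} [mu h|mu mu' r a b w la lb _ IH h].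
  by apply: bilin_ext hn => x y; rewrite h add0r.
by apply: (BilinCons la lb IH) => x y; rewrite h addrA.
Qed.

Lemma bilin_sum k (a : nat -> U -> K^o) (b : nat -> V -> K^o) (w : nat -> W) :
  (forall i, linear (a i)) -> (forall i, linear (b i)) ->
  bilin_alg (fun x y => \sum_(i < k) ((a i x : K) * b i y) *: w i) k.
Proof.
move=> la lb; elim: k => [|k IH]; first by apply: BilinNil => x y; rewrite big_ord0.
by apply: (BilinCons (la k) (lb k) IH) => x y; rewrite big_ord_recr addrC.
Qed.

Lemma has_bilinear_algorithmP mu r : bilin_alg mu r -> has_bilinear_algorithm mu r.
Proof.
elim=> {mu r} [mu h|mu mu' r a b w la lb _ [al [be [ws IH]]] h].
  exists (fun _ => 0), (fun _ => 0), (fun _ => 0) => x y.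
  by rewrite big_ord0.
pose fa : {linear U -> K^o} := HB.pack a (GRing.isLinear.Build K U K^o _ a la).
pose fb : {linear V -> K^o} := HB.pack b (GRing.isLinear.Build K V K^o _ b lb).
exists (fun i => if unlift ord0 i is Some j then al j else linfun fa),
  (fun i => if unlift ord0 i is Some j then be j else linfun fb),
  (fun i => if unlift ord0 i is Some j then ws j else w) => x y.
rewrite big_ord_recl unlift_none !lfunE h IH; congr (_ + _).
by apply: eq_bigr => i _; rewrite liftK.
Qed.

End Closure.

Lemma bilin_swap (U V W : vectType K) (mu : U -> V -> W) r :
  bilin_alg mu r -> bilin_alg (fun y x => mu x y) r.
Proof.
elim=> {mu r} [mu h|mu mu' r a b w la lb _ IH h]; first by apply: BilinNil.
by apply: (BilinCons lb la IH) => x y; rewrite h mulrC.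
Qed.

Lemma bilin_comp (U V W U' V' W' : vectType K) (mu : U -> V -> W) r
    (f : U' -> U) (g : V' -> V) (h : W -> W') :
  linear f -> linear g -> linear h -> bilin_alg mu r ->
  bilin_alg (fun x y => h (mu (f x) (g y))) r.
Proof.
move=> lf lg lh.
have h0 : h 0 = 0 by have := lh (-1) 0 0; rewrite scaler0 add0r scaleN1r addNr.
elim=> {mu r} [mu e|mu mu' r a b w la lb _ IH e].
  by apply: BilinNil => x y; rewrite e.
apply: (@BilinCons _ _ _ _ _ _ _ (a \o f) (b \o g) (h w) _ _ IH).
- by move=> c x y /=; rewrite lf la.
- by move=> c x y /=; rewrite lg lb.
- by move=> x y /=; rewrite e lh.
Qed.

End BilinearAlgorithms.

(** For alpha = a + i a' and beta = b + i b', the products p = a b, q = a' b' and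
    r = (a + a') (b + b') give alpha beta w = p (1 - i) w + q (-1 - i) w + r i w;
    the real-linear map h sends these complex multiples of w to fixed vectors. *)
Lemma bilin_realify (R : realType) (U V W' : vectType R) (X Y W : vectType R[i])
    (mu : X -> Y -> W) r (f : U -> X) (g : V -> Y) (h : W -> W') :
  (forall c x y, f (c *: x + y) = Complex c 0 *: f x + f y) ->
  (forall c x y, g (c *: x + y) = Complex c 0 *: g x + g y) ->
  (forall c x y, h (Complex c 0 *: x + y) = c *: h x + h y) ->
  bilin_alg mu r -> bilin_alg (fun x y => h (mu (f x) (g y))) (3 * r).
Proof.
move=> lf lg lh; elim=> {mu r} [mu e|mu mu' r a b w la lb _ IH e].
  apply: BilinNil => x y; rewrite e; have := lh (-1) 0 0.
  by rewrite scaler0 add0r scaleN1r addNr.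
have lRe (Z : vectType R[i]) (k : Z -> R[i]^o) (T : vectType R) (q : T -> Z) :
    (forall c x y, q (c *: x + y) = Complex c 0 *: q x + q y) -> linear k ->
    linear (fun x => complex.Re (k (q x)) : R^o).
  by move=> lq lk c x y; rewrite lq lk cReD; congr (_ + _);
    rewrite -[LHS]/(complex.Re (Complex c 0 * (k (q x) : R[i]))) cReM /= mul0r subr0.
have lIm (Z : vectType R[i]) (k : Z -> R[i]^o) (T : vectType R) (q : T -> Z) :
    (forall c x y, q (c *: x + y) = Complex c 0 *: q x + q y) -> linear k ->
    linear (fun x => complex.Im (k (q x)) : R^o).
  by move=> lq lk c x y; rewrite lq lk cImD; congr (_ + _);
    rewrite -[LHS]/(complex.Im (Complex c 0 * (k (q x) : R[i]))) cImM /= mul0r addr0.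
have lS (T : vectType R) (k l : T -> R^o) : linear k -> linear l ->
    linear (fun x => k x + l x).
  by move=> lk ll c x y; rewrite lk ll scalerDr addrACA.
have arf := lRe _ _ _ _ lf la; have aif := lIm _ _ _ _ lf la.
have brg := lRe _ _ _ _ lg lb; have big := lIm _ _ _ _ lg lb.
have -> : (3 * r.+1 = (3 * r).+3)%N by lia.
have hD x y : h (x + y) = h x + h y.
  by rewrite -[x in LHS]scale1r -[1 : R[i]]/(Complex 1 0) lh scale1r.
have hZ c x : h (Complex c 0 *: x) = c *: h x.
  have h0 : h 0 = 0 by have := lh (-1) 0 0; rewrite scaler0 add0r scaleN1r addNr.
  by rewrite -[_ *: x]addr0 lh h0 addr0.
pose ar x := complex.Re (a (f x)); pose ai x := complex.Im (a (f x)).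
pose br y := complex.Re (b (g y)); pose bi y := complex.Im (b (g y)).
have h1 := BilinCons (w := h (im_unit R *: w))
  (mu' := fun x y => ((ar x + ai x) * (br y + bi y)) *: h (im_unit R *: w) + h (mu (f x) (g y)))
  (lS _ _ _ arf aif) (lS _ _ _ brg big) IH (fun x y => erefl).
have h2 := BilinCons (w := h (Complex (-1) (-1) *: w))
  (mu' := fun x y => (ai x * bi y) *: h (Complex (-1) (-1) *: w) + _)
  aif big h1 (fun x y => erefl).
apply: (BilinCons (w := h (Complex 1 (-1) *: w)) arf brg h2) => x y.
rewrite e hD !addrA; congr (_ + _).
rewrite /ar /ai /br /bi; move: (a (f x) : R[i]) (b (g y) : R[i]) => [p q] [s t] /=.
rewrite -!hZ -!hD !scalerA -!scalerDl; congr (h (_ *: _)).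
by apply: complex_ext; rewrite ?(cReD, cImD, cReM, cImM) /=; ring.
Qed.

(** * The number of products of scalars *)

Section Counting.
Variable K : fieldType.
Hypothesis two_neq0 : (2 : K) != 0.

Lemma cf_linear n i : linear (fun x : cd K n => cf x i : K^o).
Proof. by move=> a x y; rewrite cfD cfZ. Qed.

(** One coordinate is missing from the expansion of an imaginary element; this is
    where each of the six terms gains one product over the naive count. *)
Lemma Im_sum m (x : cd K m) :
  cdIm x = \sum_(i < (2 ^ m).-1) cf x i.+1 *: mkcd m (fun j => (j == i.+1)%:R).
Proof.
apply: cf_inj => j; rewrite cf_Im // cf_sum.
have p := expn_gt0 2 m; case: (ltnP j (2 ^ m)) => hj; last first.
  rewrite (cf_oversize x hj) if_same big1 // => i _.
  by rewrite cfZ (cf_oversize _ hj) mulr0.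
case: j hj => [|j] hj.
  by rewrite /= big1 // => i _; rewrite cfZ cf_mk ?mulr0.
have hj' : (j < (2 ^ m).-1)%N by lia.
rewrite (bigD1 (Ordinal hj')) //= cfZ cf_mk // eqxx mulr1 big1 ?addr0 // => i.
rewrite -val_eqE /= => hi; rewrite cfZ cf_mk // eqSS eq_sym (negPf hi).
by rewrite mulr0.
Qed.

Lemma sum_ord_pred (F : nat -> K) N : (0 < N)%N ->
  \sum_(j < N) F j = F 0%N + \sum_(i < N.-1) F i.+1.
Proof. by case: N => // N _; rewrite big_ord_recl. Qed.

Lemma dot_Im m (x y : cd K m) :
  dot (cdIm x) (cdIm y) = \sum_(i < (2 ^ m).-1) cf x i.+1 * cf y i.+1.
Proof.
rewrite dotE (sum_ord_pred (fun j => cf (cdIm x) j * cf (cdIm y) j)) ?expn_gt0 //.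
rewrite !cf_Im // mul0r add0r; apply: eq_bigr => i _.
by rewrite !cf_Im.
Qed.

Section Blocks.
Variables (U V W : vectType K) (m : nat) (h : cd K m -> W).
Hypothesis lh : linear h.

Let h_sum k (F : 'I_k -> K) (G : 'I_k -> cd K m) :
  h (\sum_i F i *: G i) = \sum_i F i *: h (G i).
Proof.
pose fh : {linear cd K m -> W} := HB.pack h (GRing.isLinear.Build K _ W _ h lh).
by rewrite -[h]/(fh : _ -> _) linear_sum; apply: eq_bigr => i _; rewrite linearZ.
Qed.

Lemma bilin_scale_Im (g : U -> K^o) (f : V -> cd K m) : linear g -> linear f ->
  bilin_alg (fun x y => h ((g x : K) *: cdIm (f y))) (2 ^ m).-1.
Proof.
move=> lg lf; pose b (i : nat) y : K^o := cf (f y) i.+1.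
have lb i : linear (b i) by move=> c x y; rewrite /b lf cfD cfZ.
apply: bilin_ext (bilin_sum _ (fun i => h (mkcd m (fun j => (j == i.+1)%:R)))
  (fun _ => lg) lb) => x y.
rewrite Im_sum scaler_sumr -h_sum; congr (h _).
by apply: eq_bigr => i _; rewrite scalerA.
Qed.

Lemma bilin_dot_Im (f : U -> cd K m) (g : V -> cd K m) : linear f -> linear g ->
  bilin_alg (fun x y => h (cdscal m (dot (cdIm (f x)) (cdIm (g y))))) (2 ^ m).-1.
Proof.
move=> lf lg; pose a (i : nat) x : K^o := cf (f x) i.+1.
pose b (i : nat) y : K^o := cf (g y) i.+1.
have la i : linear (a i) by move=> c x y; rewrite /a lf cfD cfZ.
have lb i : linear (b i) by move=> c x y; rewrite /b lg cfD cfZ.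
apply: bilin_ext (bilin_sum _ (fun i => h (cdscal m 1)) la lb) => x y.
rewrite -h_sum; congr (h _); rewrite dot_Im.
apply: cf_inj => i; rewrite cf_sum cf_scal; case: ifP => h0.
  by apply: eq_bigr => j _; rewrite cfZ cf_scal h0 mulr1.
by rewrite big1 // => j _; rewrite cfZ cf_scal h0 mulr0.
Qed.
End Blocks.

(** The part of a cross product at level m + 1 that is not made of cross
    products at level m. *)
Definition cross_rest m (X Y : cd K m.+1) : cd K m.+1 :=
  let u := cdIm (X.1 : cd K m) in let s := cdIm (X.2 : cd K m) in
  let v := cdIm (Y.1 : cd K m) in let t := cdIm (Y.2 : cd K m) in
  let g := cf (X.2 : cd K m) 0 in let d := cf (Y.2 : cd K m) 0 in
  (g *: t - d *: s, cdscal m (dot s v - dot t u) + d *: u - g *: v).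

Lemma bilin_cross_rest m : bilin_alg (@cross_rest m) (6 * (2 ^ m).-1).
Proof.
have l1 : linear (fun X : cd K m.+1 => X.1 : cd K m) by [].
have l2 : linear (fun X : cd K m.+1 => X.2 : cd K m) by [].
have lg : linear (fun X : cd K m.+1 => cf (X.2 : cd K m) 0 : K^o).
  by move=> a x y; rewrite cfD cfZ.
have z (a : K) : (0 : cd K m) = a *: 0 + 0 by rewrite scaler0 addr0.
have n (a : K) (x y : cd K m) : - (a *: x + y) = a *: (- x) - y by rewrite opprD scalerN.
have hF : linear (fun Z : cd K m => (Z, 0) : cd K m.+1).
  by move=> a x y; congr (_, _); exact: z.
have hG : linear (fun Z : cd K m => (0, Z) : cd K m.+1).
  by move=> a x y; congr (_, _); exact: z.
have hFN : linear (fun Z : cd K m => (- Z, 0) : cd K m.+1).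
  by move=> a x y; congr (_, _); [exact: n | exact: z].
have hGN : linear (fun Z : cd K m => (0, - Z) : cd K m.+1).
  by move=> a x y; congr (_, _); [exact: z | exact: n].
have h := bilin_add (bilin_scale_Im hF lg l2)
  (bilin_add (bilin_swap (bilin_scale_Im hFN lg l2))
  (bilin_add (bilin_dot_Im hG l2 l1)
  (bilin_add (bilin_swap (bilin_dot_Im hGN l2 l1))
  (bilin_add (bilin_swap (bilin_scale_Im hG lg l1))
             (bilin_scale_Im hGN lg l1))))).
have -> : (6 * (2 ^ m).-1 = (2 ^ m).-1 + ((2 ^ m).-1 + ((2 ^ m).-1 + ((2 ^ m).-1 +
  ((2 ^ m).-1 + (2 ^ m).-1)))))%N by lia.
apply: bilin_ext h => X Y; rewrite /cross_rest; congr (_, _) => /=.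
  by rewrite !addr0.
rewrite !add0r !addrA; congr (_ - _); congr (_ + _).
by apply: cf_inj => i; rewrite cfD cfN !cf_scal; case: ifP; rewrite ?subr0.
Qed.

End Counting.

(** The recurrence also holds between levels 0 and 1, where it gives 0. *)
Fixpoint cross_count (n : nat) : nat :=
  if n is m.+1 then (2 * cross_count m + 6 * (2 ^ m).-1)%N else 0%N.

Definition real_cross_count (n : nat) : nat :=
  if n is m.+1 then (3 * cross_count m + 6 * (2 ^ m).-1)%N else 0%N.

Lemma mul_lengthE n : (0 < n)%N ->
  (1 + 3 * (2 ^ n).-1 + real_cross_count n)%N%:Z = mul_length n.
Proof.
case: n => [//|[//|n]] _; rewrite /mul_length.
have -> : real_cross_count n.+2 = (3 * cross_count n.+1 + 6 * (2 ^ n.+1).-1)%N by [].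
suff e : (cross_count n.+1)%:Z = (6 * n%:Z - 6) * (2 ^ n)%:Z + 6.
  have p := expn_gt0 2 n; rewrite !expnS; move: (cross_count _) (2 ^ n)%N e p => c T e p.
  lia.
elim: n => [//|n IH].
have -> : cross_count n.+2 = (2 * cross_count n.+1 + 6 * (2 ^ n.+1).-1)%N by [].
have p := expn_gt0 2 n; rewrite !expnS; move: (cross_count _) (2 ^ n)%N IH p => c T IH p.
lia.
Qed.

Section AlgorithmCounts.
Variable R : realType.
Local Notation C := R[i].

Lemma cdIm_imag (K : fieldType) n (x : cd K n) : (2 : K) != 0 -> imag x -> cdIm x = x.
Proof.
move=> h hx; apply: cf_inj => i; rewrite cf_Im //.
by case: eqP => [->|].
Qed.

Let twoC := two_neq0_complex R.
Let twoR := two_neq0_real R.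

Lemma algC_rest m (X Y : cd C m.+2) : imag X -> imag Y ->
  let u : cd C m.+1 := X.1 in let s := cdIm (X.2 : cd C m.+1) in
  let v : cd C m.+1 := Y.1 in let t := cdIm (Y.2 : cd C m.+1) in
  let Zp := algC (u + im_unit R *: s) (v + im_unit R *: t) in
  let Zm := algC (u - im_unit R *: s) (v - im_unit R *: t) in
  algC X Y = (2^-1 *: (Zp + Zm), (im_unit R / 2) *: (Zp - Zm)) + cross_rest X Y.
Proof.
move=> hX hY u s v t Zp Zm; rewrite algC_step /= /cross_rest !scalar_partE //.
rewrite (cdIm_imag twoC (imag_fst hX)) (cdIm_imag twoC (imag_fst hY)).
by congr (_, _); [rewrite /= addrA | rewrite /= [RHS]addrC].
Qed.

Lemma algR_rest m (X Y : cd R m.+2) : imag X -> imag Y ->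
  let u : cd R m.+1 := X.1 in let s := cdIm (X.2 : cd R m.+1) in
  let v : cd R m.+1 := Y.1 in let t := cdIm (Y.2 : cd R m.+1) in
  let Z := algC (cplx u s) (cplx v t) in
  algR X Y = (cdRec Z, - cdImc Z) + cross_rest X Y.
Proof.
move=> hX hY u s v t Z; rewrite algR_step /= /cross_rest !scalar_partE //.
rewrite (cdIm_imag twoR (imag_fst hX)) (cdIm_imag twoR (imag_fst hY)).
by congr (_, _); [rewrite /= addrA | rewrite /= [RHS]addrC].
Qed.

(** The bilinear map agrees with C_n on imaginary operands only: elsewhere C_n
    would need one more product for each of d u and g v, whose vectors are
    replaced by their imaginary parts here. *)
Lemma bilin_algC n : exists2 mu : cd C n -> cd C n -> cd C n,
  bilin_alg mu (cross_count n) &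
  forall X Y, imag X -> imag Y -> algC X Y = mu X Y.
Proof.
elim: n => [|[_|n [mu hmu e]]]; try by exists (fun _ _ => 0) => //; apply: BilinNil.
pose j := im_unit R; pose Cm := cd C n.+1; pose Cn := cd C n.+2.
have lp (a : C) : linear (fun X : Cn => cdIm (X.1 : Cm) + a *: cdIm (X.2 : Cm)).
  move=> c x y; by rewrite !Im_linear // !scalerDr !scalerA [a * c]mulrC addrACA.
have lh (a b : C) : linear (fun Z : Cm => (a *: Z, b *: Z) : Cn).
  by move=> c x y; congr (_, _); rewrite /= scalerDr !scalerA [_ * c]mulrC.
have h := bilin_add (bilin_add (bilin_comp (lp j) (lp j) (lh 2^-1 (j / 2)) hmu)
  (bilin_comp (lp (- j)) (lp (- j)) (lh 2^-1 (- (j / 2))) hmu))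
  (bilin_cross_rest twoC n.+1).
have -> : (cross_count n.+2 = cross_count n.+1 + cross_count n.+1 + 6 * (2 ^ n.+1).-1)%N.
  by rewrite addnn -mul2n.
eexists; first by apply: bilin_ext h => X Y; reflexivity.
move=> X Y hX hY; have hu := imag_fst hX; have hv := imag_fst hY.
have hs := imag_Im twoC (X.2 : Cm); have ht := imag_Im twoC (Y.2 : Cm).
rewrite algC_rest //= (cdIm_imag twoC hu) (cdIm_imag twoC hv) !scaleNr; congr (_ + _).
move: (cdIm (X.2 : Cm)) (cdIm (Y.2 : Cm)) hs ht => s t hs ht.
have hj (x y : Cm) : imag x -> imag y -> imag (x + j *: y).
  by move=> *; apply: imagD => //; apply: imagZ.
have hNj (x y : Cm) : imag x -> imag y -> imag (x - j *: y).
  by move=> *; rewrite -scaleNr; apply: imagD => //; apply: imagZ.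
rewrite !e; try by [apply: hj | apply: hNj].
by congr (_, _); [rewrite scalerDr | rewrite scalerBr].
Qed.

Lemma bilin_algR n : (0 < n)%N -> exists2 mu : cd R n -> cd R n -> cd R n,
  bilin_alg mu (real_cross_count n) &
  forall X Y, imag X -> imag Y -> algR X Y = mu X Y.
Proof.
case: n => [//|[|n]] _; first by exists (fun _ _ => 0) => //; apply: BilinNil.
have [mu hmu e] := bilin_algC n.+1.
pose Rm := cd R n.+1; pose Rn := cd R n.+2.
have lp c (x y : Rn) : cplx (cdIm ((c *: x + y).1 : Rm)) (cdIm ((c *: x + y).2 : Rm)) =
    Complex c 0 *: cplx (cdIm (x.1 : Rm)) (cdIm (x.2 : Rm))
    + cplx (cdIm (y.1 : Rm)) (cdIm (y.2 : Rm)).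
  by rewrite !Im_linear // cplx_linear.
have lh c (x y : cd C n.+1) :
    (cdRec (Complex c 0 *: x + y), - cdImc (Complex c 0 *: x + y)) =
    c *: (cdRec x, - cdImc x) + (cdRec y, - cdImc y) :> Rn.
  by rewrite cdRec_linear cdImc_linear; congr (_, _); rewrite /= opprD scalerN.
have h := bilin_add (bilin_realify lp lp lh hmu) (bilin_cross_rest twoR n.+1).
eexists; first exact: h.
move=> X Y hX hY; have hu := imag_fst hX; have hv := imag_fst hY.
have hs := imag_Im twoR (X.2 : Rm); have ht := imag_Im twoR (Y.2 : Rm).
rewrite algR_rest //= (cdIm_imag twoR hu) (cdIm_imag twoR hv).
by rewrite e //; exact: cplx_imag.
Qed.

Lemma bilin_cdmul n : (0 < n)%N ->
  bilin_alg (@cdmul R n) (1 + 3 * (2 ^ n).-1 + real_cross_count n).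
Proof.
move=> n0; have [mu hmu e] := bilin_algR n0.
have lid : linear (fun x : cd R n => x) by [].
have lopp : linear (fun x : cd R n => - x) by move=> a x y; rewrite opprD scalerN.
have l0 := @cf_linear R n 0.
have lI := @Im_linear R twoR n.
have h := bilin_add (bilin_add (bilin_add (bilin_add
  (bilin_sum 1 (fun _ => cdscal n (1 : R)) (fun _ => l0) (fun _ => l0))
  (bilin_dot_Im twoR lopp lid lid)) (bilin_scale_Im twoR lid l0 lid))
  (bilin_swap (bilin_scale_Im twoR lid l0 lid))) (bilin_comp lI lI lid hmu).
have -> : (1 + 3 * (2 ^ n).-1 = 1 + (2 ^ n).-1 + (2 ^ n).-1 + (2 ^ n).-1)%N by lia.
apply: bilin_ext h => x y; rewrite big_ord1 -algM_mul.
case: n n0 mu hmu e lid lopp l0 lI x y => // n n0 mu hmu e lid lopp l0 lI x y.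
rewrite -e; try exact: imag_Im.
rewrite -[LHS]/(cdscal n.+1 (scalar_part x * scalar_part y - dot (cdIm x) (cdIm y))
  + scalar_part x *: cdIm y + scalar_part y *: cdIm x + algR (cdIm x) (cdIm y)).
rewrite !scalar_partE //; congr (_ + _ + _ + _).
apply: cf_inj => i; rewrite cfD cfN cfZ !cf_scal.
by case: ifP => _; rewrite ?mulr1 ?mulr0 ?subrr.
Qed.

End AlgorithmCounts.

(** * An interpreter for code without calls *)

Section Interpreter.
Variable R : realType.
Implicit Types (g h : nat -> R) (env : seq nat) (c : cmd R).

(** Memories are functions on addresses, so that no size appears in the
    description of their contents; mkseq g s is the memory of size s. *)
Definition upd g a v : nat -> R := fun b => if b == a then v else g b.

Fixpoint run env c g : nat -> R :=
  match c with
  | Skip => g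
  | Seq c1 c2 => run env c2 (run env c1 g)
  | Const e r => upd g (ieval env e) r
  | Copy e e1 => upd g (ieval env e) (g (ieval env e1))
  | Arith o e e1 e2 =>
      upd g (ieval env e) (arith_eval o (g (ieval env e1)) (g (ieval env e2)))
  | Scale e r e1 => upd g (ieval env e) (r * g (ieval env e1))
  | For e c => iteri (ieval env e) (fun i => run (rcons env i) c) g
  | IfLe e1 e2 c1 c2 => if (ieval env e1 <= ieval env e2)%N then run env c1 g else run env c2 g
  | Call _ _ _ _ _ _ => g
  end.

(** All accesses are below s.  Like ops and prods below, this is a function of
    the index variables, because control never depends on stored reals. *)
Fixpoint safe env (s : nat) c : Prop :=
  match c with
  | Skip => True
  | Seq c1 c2 => safe env s c1 /\ safe env s c2
  | Const e r => (ieval env e < s)%N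
  | Copy e e1 => (ieval env e < s)%N /\ (ieval env e1 < s)%N
  | Arith o e e1 e2 => [/\ (ieval env e < s)%N, (ieval env e1 < s)%N & (ieval env e2 < s)%N]
  | Scale e r e1 => (ieval env e < s)%N /\ (ieval env e1 < s)%N
  | For e c => forall i, (i < ieval env e)%N -> safe (rcons env i) s c
  | IfLe e1 e2 c1 c2 => if (ieval env e1 <= ieval env e2)%N then safe env s c1 else safe env s c2
  | Call _ _ _ _ _ _ => False
  end.

Fixpoint ops env c : nat :=
  match c with
  | Seq c1 c2 => ops env c1 + ops env c2
  | Arith _ _ _ _ | Scale _ _ _ => 1
  | For e c => \sum_(i < ieval env e) ops (rcons env i) c
  | IfLe e1 e2 c1 c2 => if (ieval env e1 <= ieval env e2)%N then ops env c1 else ops env c2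
  | _ => 0
  end%N.

Fixpoint prods env c : nat :=
  match c with
  | Seq c1 c2 => prods env c1 + prods env c2
  | Arith Mul _ _ _ => 1
  | For e c => \sum_(i < ieval env e) prods (rcons env i) c
  | IfLe e1 e2 c1 c2 => if (ieval env e1 <= ieval env e2)%N then prods env c1 else prods env c2
  | _ => 0
  end%N.

Lemma set_nth_mkseq g s a v : (a < s)%N -> set_nth 0 (mkseq g s) a v = mkseq (upd g a v) s.
Proof.
move=> ha; apply: (@eq_from_nth _ 0); first by rewrite size_set_nth !size_mkseq; lia.
move=> i; rewrite size_set_nth size_mkseq => hi; have {}hi : (i < s)%N by lia.
by rewrite nth_set_nth /= !nth_mkseq // /upd; case: eqP.
Qed.

(** The only induction on the syntax of commands that is needed: for code without
    calls, running it is computing run, ops and prods. *)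
Lemma exec_run P env c g s : safe env s c ->
  exec P env c (mkseq g s) (mkseq (run env c g) s) (ops env c) (prods env c) [::].
Proof.
elim: c env g => [|c1 IH1 c2 IH2|e r|e e1|o e e1 e2|e r e1|e c IH|e1 e2 c1 IH1 c2 IH2|] env g //=.
- by move=> _; constructor.
- by case=> h1 h2; apply: (ESeq (IH1 env g h1) (IH2 env _ h2)).
- move=> h; rewrite -set_nth_mkseq //; apply: EConst; by rewrite size_mkseq.
- case=> h1 h2; rewrite -set_nth_mkseq // -(nth_mkseq 0 g h2).
  by apply: ECopy; rewrite size_mkseq.
- case=> h h1 h2; rewrite -set_nth_mkseq // -(nth_mkseq 0 g h1) -(nth_mkseq 0 g h2).
  by apply: EArith; rewrite size_mkseq.
- case=> h h1; rewrite -set_nth_mkseq // -(nth_mkseq 0 g h1).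
  by apply: EScale; rewrite size_mkseq.
- move=> hs; apply: EFor; elim: (ieval env e) hs => [|n IHn] hs.
    by rewrite !big_ord0; apply: ELoop0.
  rewrite !big_ord_recr /= -[[::]]/([::] ++ [::]); apply: ELoopS.
    by apply: IHn => i hi; apply: hs; apply: ltnW.
  by apply: IH; apply: hs.
- by move=> hs; apply: EIfLe; move: hs; case: ifP => _ hs; [apply: IH1|apply: IH2].
Qed.

Lemma run_seq env c1 c2 g : run env (Seq c1 c2) g = run env c2 (run env c1 g).
Proof. by []. Qed.

Lemma run_const env e r g : run env (Const e r) g = upd g (ieval env e) r.
Proof. by []. Qed.

Lemma run_copy env e e1 g :
  run env (Copy _ e e1) g = upd g (ieval env e) (g (ieval env e1)).
Proof. by []. Qed.

Lemma run_arith env o e e1 e2 g : run env (Arith _ o e e1 e2) g =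
  upd g (ieval env e) (arith_eval o (g (ieval env e1)) (g (ieval env e2))).
Proof. by []. Qed.

Lemma run_scale env e r e1 g :
  run env (Scale e r e1) g = upd g (ieval env e) (r * g (ieval env e1)).
Proof. by []. Qed.

Lemma run_ifle env e1 e2 c1 c2 g : run env (IfLe e1 e2 c1 c2) g =
  if (ieval env e1 <= ieval env e2)%N then run env c1 g else run env c2 g.
Proof. by []. Qed.

Lemma run_for (I : nat -> (nat -> R) -> Prop) env e c g :
  I 0%N g ->
  (forall i h, (i < ieval env e)%N -> I i h -> I i.+1 (run (rcons env i) c h)) ->
  I (ieval env e) (run env (For e c) g).
Proof.
move=> h0 hs /=; elim: (ieval env e) hs => [//|n IH] hs /=.
by apply: (hs) => //; apply: IH => i h hi; apply: hs; apply: ltnW.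
Qed.

Lemma upd_same (g : nat -> R) a v b : b = a -> upd g a v b = v.
Proof. by rewrite /upd => ->; rewrite eqxx. Qed.

Lemma upd_other (g : nat -> R) a v b : b <> a -> upd g a v b = g b.
Proof. by rewrite /upd; case: eqP. Qed.

End Interpreter.
Arguments upd : simpl never.
Arguments run : simpl never.

(** Reads through updates at addresses that linear arithmetic separates. *)
Ltac readm := repeat match goal with |- context [upd ?g ?a ?v ?b] =>
  first [rewrite (@upd_same _ g a v b); [|reflexivity]
       | rewrite (@upd_other _ g a v b); [|lia] | rewrite (@upd_same _ g a v b); [|lia]] end.

Local Notation "e1 :+ e2" := (IAdd e1 e2) (at level 50, left associativity).
Local Notation "c1 ;; c2" := (Seq c1 c2) (at level 100, right associativity).

(** * The program *)

Section Program.
Variable R : realType.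
Local Notation C := R[i].

(** The index variables of an activation are the level, the addresses of the two
    operands, of the result and of the workspace, and one loop counter. *)
Definition lev := IVar 0.
Definition opx := IVar 1.
Definition opy := IVar 2.
Definition res := IVar 3.
Definition wsp := IVar 4.
Definition idx := IVar 5.
(** 2 ^ n and 2 ^ (n - 1): the dimensions at the current level and one below. *)
Definition fdim := IPow2 lev.
Definition hdim := IPow2 (ISub lev (INat 1)).

Definition addsub (neg : bool) := if neg then Defs.Sub else Add.

(** d, a and b are indices of coordinates in the result and the operands. *)
Definition fmaR (neg : bool) (d a b : iexp) : cmd R :=
  Arith _ Mul wsp (opx :+ a) (opy :+ b) ;;
  Arith _ (addsub neg) (res :+ d) (res :+ d) wsp.

Definition mulC3 (a b a' b' : iexp) : cmd R :=
  let p := wsp in let q := wsp :+ INat 1 in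
  let r := wsp :+ INat 2 in let s := wsp :+ INat 3 in
  Arith _ Mul p a b ;;
  Arith _ Mul q a' b' ;;
  Arith _ Add r a a' ;;
  Arith _ Add s b b' ;;
  Arith _ Mul r r s ;;
  Arith _ Defs.Sub r r p ;;
  Arith _ Defs.Sub r r q ;;
  Arith _ Defs.Sub p p q.

(** Imaginary parts are stored 2 ^ n cells after real parts. *)
Definition fmaC (neg : bool) (d a b : iexp) : cmd R :=
  mulC3 (opx :+ a) (opy :+ b) (opx :+ (fdim :+ a)) (opy :+ (fdim :+ b)) ;;
  Arith _ (addsub neg) (res :+ d) (res :+ d) wsp ;;
  Arith _ (addsub neg) (res :+ (fdim :+ d)) (res :+ (fdim :+ d)) (wsp :+ INat 2).

(** With H = 2 ^ (n - 1), cell H of an operand (u, g + s) holds g, and for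
    0 < i < H the cells i and H + i hold the coordinates i of u and s.  Iteration
    i - 1 adds g t_i and - d s_i to F_i, s_i v_i and - t_i u_i to G_0, and d u_i
    and - g v_i to G_i, so each product involves imaginary coordinates only. *)
Definition add_rest (fma : bool -> iexp -> iexp -> iexp -> cmd R) : cmd R :=
  let i := idx :+ INat 1 in let j := hdim :+ i in
  For (ISub hdim (INat 1))
    (fma false i hdim j ;; fma true i j hdim ;;
     fma false hdim j i ;; fma true hdim i j ;;
     fma false j i hdim ;; fma true j hdim i).

(** Erasing one cell of a copy: for k = 0 this is the imaginary part; for
    k = 2 ^ (n - 1) it removes the scalar g from (u, g + s), and what is left is
    the storage of u + i s, real parts first. *)
Definition copy_but (src dst len k : iexp) : cmd R :=
  For len (Copy _ (dst :+ idx) (src :+ idx)) ;; Const (dst :+ k) 0.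

(** u + i s or u - i s, for a complexified operand (u, g + s) stored as the real
    parts of u and g + s followed by their imaginary parts.  The loop treats g as
    a coordinate of s, which only affects the two cells erased at the end. *)
Definition twist (neg : bool) (src dst : iexp) : cmd R :=
  For hdim
    (Arith _ (addsub (~~ neg)) (dst :+ idx) (src :+ idx) (src :+ (fdim :+ (hdim :+ idx))) ;;
     Arith _ (addsub neg) (dst :+ (hdim :+ idx)) (src :+ (fdim :+ idx)) (src :+ (hdim :+ idx))) ;;
  Const dst 0 ;; Const (dst :+ hdim) 0.

(** The real and imaginary parts a, b of the first result and c, d of the second
    are replaced by the real parts (a + c) / 2, (d - b) / 2 and the imaginary
    parts (b + d) / 2, (a - c) / 2 of half the sum and of i / 2 times the
    difference, in the order of the output. *)
Definition combine : cmd R :=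
  let p := wsp in let q := wsp :+ INat 1 in
  let a := res :+ idx in let b := res :+ (hdim :+ idx) in
  let c := res :+ (fdim :+ idx) in let d := res :+ (fdim :+ (hdim :+ idx)) in
  For hdim
    (Arith _ Defs.Sub p a c ;; Arith _ Defs.Sub q d b ;;
     Arith _ Add a a c ;; Arith _ Add c b d ;;
     Scale a 2^-1 a ;; Scale b 2^-1 q ;; Scale c 2^-1 c ;; Scale d 2^-1 p).

(** The output area, of size 2 * 2 ^ n, is exactly large enough for the results
    of the two calls. *)
Definition procC : cmd R :=
  let A := wsp :+ INat 4 in let B := A :+ fdim in let W := B :+ fdim in
  IfLe lev (INat 1) (For (fdim :+ fdim) (Const (res :+ idx) 0))
    (twist false opx A ;; twist false opy B ;;
     Call _ AlgC (ISub lev (INat 1)) A B res W ;;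
     twist true opx A ;; twist true opy B ;;
     Call _ AlgC (ISub lev (INat 1)) A B (res :+ fdim) W ;;
     combine ;; add_rest fmaC).

(** The result of the call is the real and imaginary parts in sequence, which are
    the two components of the output up to the sign of the second. *)
Definition procR : cmd R :=
  let A := wsp :+ INat 1 in let B := A :+ fdim in let W := B :+ fdim in
  IfLe lev (INat 1) (For fdim (Const (res :+ idx) 0))
    (copy_but opx A fdim hdim ;; copy_but opy B fdim hdim ;;
     Call _ AlgC (ISub lev (INat 1)) A B res W ;;
     For hdim (Scale (res :+ (hdim :+ idx)) (-1) (res :+ (hdim :+ idx))) ;;
     add_rest fmaR).

Definition procM : cmd R :=
  let A := wsp :+ INat 1 in let B := A :+ fdim in let W := B :+ fdim in
  let i := idx :+ INat 1 in
  copy_but opx A fdim (INat 0) ;; copy_but opy B fdim (INat 0) ;;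
  Call _ AlgR lev A B res W ;;
  fmaR false (INat 0) (INat 0) (INat 0) ;;
  For (ISub fdim (INat 1))
    (fmaR true (INat 0) i i ;; fmaR false i (INat 0) i ;; fmaR false i i (INat 0)).

Definition cd_program : program R := fun a =>
  match a with AlgM => procM | AlgR => procR | AlgC => procC end.

(** * Multiply-add instructions *)

(** Three real products give a complex one: with p = a b, q = a' b' and
    r = (a + a') (b + b'), the real part is p - q and the imaginary part
    r - p - q.  Each register is tracked through the eight instructions. *)
Lemma mulC3_registers (g : nat -> R) (W a b a' b' : nat) :
    [/\ a < W, b < W, a' < W & b' < W]%N ->
  let g1 := upd g W (g a * g b) in
  let g2 := upd g1 (W + 1)%N (g1 a' * g1 b') in
  let g3 := upd g2 (W + 2)%N (g2 a + g2 a') in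
  let g4 := upd g3 (W + 3)%N (g3 b + g3 b') in
  let g5 := upd g4 (W + 2)%N (g4 (W + 2)%N * g4 (W + 3)%N) in
  let g6 := upd g5 (W + 2)%N (g5 (W + 2)%N - g5 W) in
  let g7 := upd g6 (W + 2)%N (g6 (W + 2)%N - g6 (W + 1)%N) in
  let g8 := upd g7 W (g7 W - g7 (W + 1)%N) in
  [/\ g8 W = g a * g b - g a' * g b', g8 (W + 2)%N = g a * g b' + g a' * g b
    & forall c, (c < W)%N -> g8 c = g c].
Proof.
case=> ha hb ha' hb' g1.
have l1 c : (c < W)%N -> g1 c = g c by move=> h; rewrite /g1; readm.
have p1 : g1 W = g a * g b by rewrite /g1; readm.
rewrite !l1 //; clearbody g1 => g2.
have l2 c : (c < W)%N -> g2 c = g c by move=> h; rewrite /g2; readm; exact: l1.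
have p2 : g2 W = g a * g b by rewrite /g2; readm.
have q2 : g2 (W + 1)%N = g a' * g b' by rewrite /g2; readm.
rewrite !l2 //; clearbody g2 => g3.
have l3 c : (c < W)%N -> g3 c = g c by move=> h; rewrite /g3; readm; exact: l2.
have p3 : g3 W = g a * g b by rewrite /g3; readm.
have q3 : g3 (W + 1)%N = g a' * g b' by rewrite /g3; readm.
have r3 : g3 (W + 2)%N = g a + g a' by rewrite /g3; readm.
rewrite !l3 //; clearbody g3 => g4.
have l4 c : (c < W)%N -> g4 c = g c by move=> h; rewrite /g4; readm; exact: l3.
have p4 : g4 W = g a * g b by rewrite /g4; readm.
have q4 : g4 (W + 1)%N = g a' * g b' by rewrite /g4; readm.
have r4 : g4 (W + 2)%N = g a + g a' by rewrite /g4; readm.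
have s4 : g4 (W + 3)%N = g b + g b' by rewrite /g4; readm.
rewrite r4 s4; clearbody g4 => g5.
have l5 c : (c < W)%N -> g5 c = g c by move=> h; rewrite /g5; readm; exact: l4.
have p5 : g5 W = g a * g b by rewrite /g5; readm.
have q5 : g5 (W + 1)%N = g a' * g b' by rewrite /g5; readm.
have r5 : g5 (W + 2)%N = (g a + g a') * (g b + g b') by rewrite /g5; readm.
rewrite r5 p5; clearbody g5 => g6.
have l6 c : (c < W)%N -> g6 c = g c by move=> h; rewrite /g6; readm; exact: l5.
have p6 : g6 W = g a * g b by rewrite /g6; readm.
have q6 : g6 (W + 1)%N = g a' * g b' by rewrite /g6; readm.
have r6 : g6 (W + 2)%N = (g a + g a') * (g b + g b') - g a * g b by rewrite /g6; readm.
rewrite r6 q6; clearbody g6 => g7.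
have p7 : g7 W = g a * g b by rewrite /g7; readm.
have q7 : g7 (W + 1)%N = g a' * g b' by rewrite /g7; readm.
rewrite p7 q7 /g7 /=; split; first by readm.
  by readm; ring.
by move=> c h; readm; exact: l6.
Qed.

(** * Multiply-add loops *)
(** A specification of the code that adds products to an output area of L cells
    at z, generic in the scalars: view g a i is the scalar with index i of the
    element stored at a, which takes one cell over the reals and two over the
    complex numbers.  Addresses from w on are scratch. *)
Section Fma.
Variables (K : fieldType) (view : (nat -> R) -> nat -> nat -> K).
Variable (fma : bool -> iexp -> iexp -> iexp -> cmd R).
Variables (n x y z w L : nat) (xi eta : nat -> K).

Definition outside z L w c := (c < w)%N && ((c < z) || (z + L <= c))%N.

Definition keeps (g g' : nat -> R) := forall c, outside z L w c -> g' c = g c.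

Definition inputs g :=
  forall i, (i < 2 ^ n)%N -> view g x i = xi i /\ view g y i = eta i.

(** What is added depends only on the operands xi and eta, which the code leaves
    unchanged: sequences and loops of such code add the sums. *)
Definition adds env c (e : nat -> K) := forall g, inputs g ->
  keeps g (run env c g) /\
  forall j, (j < 2 ^ n)%N -> view (run env c g) z j = view g z j + e j.

Hypothesis view_keeps : forall g g', keeps g g' -> inputs g -> inputs g'.

Lemma keeps_trans g1 g2 g3 : keeps g1 g2 -> keeps g2 g3 -> keeps g1 g3.
Proof. by move=> h1 h2 c hc; rewrite h2 // h1. Qed.

Lemma adds_seq env c1 c2 e1 e2 : adds env c1 e1 -> adds env c2 e2 ->
  adds env (c1 ;; c2) (fun j => e1 j + e2 j).
Proof.
move=> h1 h2 g hg; rewrite run_seq; have [k1 v1] := h1 g hg.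
have [k2 v2] := h2 _ (view_keeps k1 hg); split; first exact: keeps_trans k1 k2.
by move=> j hj; rewrite v2 // v1 // addrA.
Qed.

Lemma adds_for env e c f : (forall i, (i < ieval env e)%N -> adds (rcons env i) c (f i)) ->
  adds env (For e c) (fun j => \sum_(i < ieval env e) f i j).
Proof.
move=> hc g hg.
apply: (run_for (I := fun i h => keeps g h /\ forall j, (j < 2 ^ n)%N ->
  view h z j = view g z j + \sum_(k < i) f k j)).
  by split=> // j _; rewrite big_ord0 addr0.
move=> i h hi [k v]; have [k' v'] := hc i hi h (view_keeps k hg).
split; first exact: keeps_trans k k'.
by move=> j hj; rewrite v' // v // big_ord_recr addrA.
Qed.

Definition fma_term (neg : bool) d a b (j : nat) : K :=
  if j == d then (if neg then - (xi a * eta b) else xi a * eta b) else 0.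

Definition fma_correct := forall env neg d a b,
  (exists l, env = [:: n, x, y, z, w & l]) ->
  (ieval env d < 2 ^ n)%N -> (ieval env a < 2 ^ n)%N -> (ieval env b < 2 ^ n)%N ->
  adds env (fma neg d a b) (fma_term neg (ieval env d) (ieval env a) (ieval env b)).

End Fma.

Definition viewR (g : nat -> R) a i : R := g (a + i)%N.
Definition viewC n (g : nat -> R) a i : C := Complex (g (a + i)%N) (g (a + (2 ^ n + i))%N).

Section Views.
Variables (n x y z w : nat).

Section RealView.
Variables (xi eta : nat -> R).
Hypothesis ox : forall i, (i < 2 ^ n)%N -> outside z (2 ^ n) w (x + i).
Hypothesis oy : forall i, (i < 2 ^ n)%N -> outside z (2 ^ n) w (y + i).
Hypothesis zw : (z + 2 ^ n <= w)%N.

Lemma viewR_keeps g g' : keeps z w (2 ^ n) g g' ->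
  inputs viewR n x y xi eta g -> inputs viewR n x y xi eta g'.
Proof. by move=> k h i hi; have [<- <-] := h i hi; split; apply: k; auto. Qed.

Lemma fmaR_correct : fma_correct viewR fmaR n x y z w (2 ^ n) xi eta.
Proof.
move=> env neg d a b [l ->]; set E := [:: n, x, y, z, w & l] => hd ha hb g hg.
have [ea _] := hg _ ha; have [_ eb] := hg _ hb.
rewrite /fmaR run_seq !run_arith /=; move: (ieval E d) (ieval E a) (ieval E b) hd ha hb ea eb.
move=> {}d {}a {}b hd ha hb; rewrite /fma_term /viewR => <- <-.
split=> [c|j hj]; rewrite /upd.
  rewrite /outside => hc; have -> : (c == z + d)%N = false by lia.
  by have -> : (c == w) = false by lia.
rewrite eqn_add2l; have -> : (z + d == w)%N = false by lia.
have -> : (z + j == w)%N = false by lia.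
rewrite eqxx; case: eqP => [->|_]; last by rewrite addr0.
by case: neg.
Qed.

End RealView.

Section ComplexView.
Variables (xi eta : nat -> C).
Hypothesis ox : forall i, (i < 2 * 2 ^ n)%N -> outside z (2 * 2 ^ n) w (x + i).
Hypothesis oy : forall i, (i < 2 * 2 ^ n)%N -> outside z (2 * 2 ^ n) w (y + i).
Lemma viewC_keeps g g' : keeps z w (2 * 2 ^ n) g g' ->
  inputs (viewC n) n x y xi eta g -> inputs (viewC n) n x y xi eta g'.
Proof.
move=> k h i hi; have [<- <-] := h i hi.
by split; congr (Complex _ _); apply: k; (apply: ox || apply: oy); lia.
Qed.

Hypothesis zw : (z + 2 * 2 ^ n <= w)%N.

Lemma run_mulC3 env g (a b a' b' : iexp) (u v : C) :
    let W := ieval env wsp in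
    [/\ ieval env a < W, ieval env b < W, ieval env a' < W & ieval env b' < W]%N ->
    u = Complex (g (ieval env a)) (g (ieval env a')) ->
    v = Complex (g (ieval env b)) (g (ieval env b')) ->
  let h := run env (mulC3 a b a' b') g in
  [/\ h W = complex.Re (u * v), h (W + 2)%N = complex.Im (u * v)
    & forall c, (c < W)%N -> h c = g c].
Proof.
move=> W hW -> -> h; have [e1 e2 e3] := mulC3_registers g hW.
by split; rewrite ?cReM ?cImM; [exact: e1 | exact: e2 | exact: e3].
Qed.

(** The two components are updated one after the other, but both from values that
    were computed in registers before the first update. *)
Lemma fmaC_correct : fma_correct (viewC n) fmaC n x y z w (2 * 2 ^ n) xi eta.
Proof.
move=> env neg d a b [l ->]; set E := [:: n, x, y, z, w & l] => hd ha hb g hg.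
have [ea _] := hg _ ha; have [_ eb] := hg _ hb.
have oxa := ox (i := ieval E a); have oxa' := ox (i := 2 ^ n + ieval E a).
have oyb := oy (i := ieval E b); have oyb' := oy (i := 2 ^ n + ieval E b).
have lt_w : [/\ x + ieval E a < w, y + ieval E b < w, x + (2 ^ n + ieval E a) < w
    & y + (2 ^ n + ieval E b) < w]%N.
  by move: oxa oxa' oyb oyb'; rewrite /outside; split; lia.
have [] := @run_mulC3 E g (opx :+ a) (opy :+ b) (opx :+ (fdim :+ a))
  (opy :+ (fdim :+ b)) _ _ lt_w (esym ea) (esym eb).
rewrite /fmaC 2!run_seq; set h := run E (mulC3 _ _ _ _) g.
rewrite /fma_term; move: (xi _ * eta _) => uv hw hw2 hlo.
rewrite !run_arith /= in hw hw2 hlo *; clearbody h.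
rewrite /viewC; have zw' := zw; move: (ieval E d) (2 ^ n)%N hd zw' => {}d N hd zw'.
have hlo1 c : (c < w)%N -> upd h (z + d)%N
    (arith_eval (addsub neg) (h (z + d)%N) (h w)) c = if c == (z + d)%N then
     arith_eval (addsub neg) (g (z + d)%N) (complex.Re uv) else g c.
  by move=> hc; rewrite /upd hw !hlo //; lia.
set h1 := upd h _ _ in hlo1 *.
have -> : h1 (w + 2)%N = complex.Im uv by rewrite /h1 upd_other ?hw2 //; lia.
clearbody h1; have e1 : h1 (z + (N + d))%N = g (z + (N + d))%N.
  by rewrite hlo1; [case: eqP => //; lia | lia].
rewrite e1; split=> [c|j hj].
  by rewrite /outside => hc; readm; rewrite hlo1; [case: eqP => //; lia | lia].
case: (eqVneq j d) => [->|hne]; apply: complex_ext; rewrite ?cReD ?cImD /=.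
- readm; rewrite hlo1 ?eqxx; last by lia.
  by case: (neg); rewrite /= ?cReN.
- by readm; case: (neg); rewrite /= ?cImN.
- by rewrite addr0; readm; rewrite hlo1; [case: eqP => //; lia | lia].
- by rewrite addr0; readm; rewrite hlo1; [case: eqP => //; lia | lia].
Qed.

End ComplexView.
End Views.
End Program.

(** * The loop of multiply-adds computes the remaining terms *)

Section Rest.
Variable K : fieldType.
Lemma sum_delta (F : nat -> K) k n :
  \sum_(i < n) (if k == i.+1 then F i.+1 else 0) = if (0 < k <= n)%N then F k else 0.
Proof.
case: k => [|k] /=; first by rewrite big1.
case: ltnP => hk; last first.
  by rewrite big1 // => i _; have -> : (k.+1 == i.+1) = false by have := ltn_ord i; lia.
rewrite (bigD1 (Ordinal hk)) //= eqxx big1 ?addr0 // => i.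
by rewrite -val_eqE /= eqSS eq_sym => /negPf ->.
Qed.

Hypothesis two_neq0 : (2 : K) != 0.

(** The contributions of iteration k of the loop to cell j, as sums associated
    like the sequence of its six instructions. *)
Definition rest_terms (T : bool -> nat -> nat -> nat -> nat -> K) (H k j : nat) : K :=
  let i := (k + 1)%N in let q := (H + i)%N in
  T false i H q j + (T true i q H j + (T false H q i j
    + (T true H i q j + (T false q i H j + T true q H i j)))).

(** For an output index j < H or j > H at most one iteration contributes, and for
    j = H all of them do and build the two inner products. *)
Lemma cross_rest_sum m (X Y : cd K m.+1) j : (j < 2 ^ m.+1)%N ->
  let T := fma_term (cf X) (cf Y) in let H := (2 ^ m)%N in
  \sum_(k < H - 1) rest_terms T H k j = cf (cross_rest X Y) j.
Proof.
move=> hj T H; have H0 : (0 < H)%N by rewrite expn_gt0.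
have [xH yH] : cf X H = cf (X.2 : cd K m) 0 /\ cf Y H = cf (Y.2 : cd K m) 0.
  by rewrite -(addn0 H) !cf_snd.
have small (k : nat) : (k < H - 1)%N ->
  [/\ cf X (k + 1) = cf (X.1 : cd K m) k.+1, cf Y (k + 1) = cf (Y.1 : cd K m) k.+1,
      cf X (H + (k + 1)) = cf (X.2 : cd K m) k.+1 &
      cf Y (H + (k + 1)) = cf (Y.2 : cd K m) k.+1].
  by move=> hk; rewrite addn1 !cf_snd !cf_fst //; lia.
have dsv := dot_Im two_neq0 (X.2 : cd K m) (Y.1 : cd K m).
have dtu := dot_Im two_neq0 (Y.2 : cd K m) (X.1 : cd K m).
have hu := cf_Im two_neq0 (X.1 : cd K m); have hs := cf_Im two_neq0 (X.2 : cd K m).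
have hv := cf_Im two_neq0 (Y.1 : cd K m); have ht := cf_Im two_neq0 (Y.2 : cd K m).
rewrite cf_pair /cross_rest /= -/H.
move: (cdIm (X.1 : cd K m)) (cdIm (X.2 : cd K m)) hu hs dsv dtu => u s hu hs.
move: (cdIm (Y.1 : cd K m)) (cdIm (Y.2 : cd K m)) hv ht => v t hv ht dsv dtu.
case: (ltnP j H) => hjH.
  rewrite cfD cfN !cfZ hs ht.
  pose F k := cf (X.2 : cd K m) 0 * cf (Y.2 : cd K m) k - cf (X.2 : cd K m) k * cf (Y.2 : cd K m) 0.
  transitivity (\sum_(k < H - 1) (if j == k.+1 then F k.+1 else 0)).
    apply: eq_bigr => k _; have [e1 e2 e3 e4] := small k (ltn_ord k).
    rewrite /rest_terms /T /fma_term !e1 !e2 !e3 !e4 xH yH addn1.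
    have -> : (j == H) = false by lia.
    have -> : (j == (H + k.+1)%N) = false by lia.
    by case: eqP => _; rewrite /F; ring.
  rewrite sum_delta /F; case: j hj hjH => [|j] hj hjH; first by rewrite /= !mulr0 subrr.
  have -> : (0 < j.+1 <= H - 1)%N by lia.
  rewrite /=; ring.
have [j' ej hj'] : exists2 j', j = (H + j')%N & (j' < H)%N.
  by exists (j - H)%N; [lia | move: hj; rewrite expnS -/H; lia].
rewrite {j hj hjH}ej addKn; rename j' into j; rename hj' into hj.
rewrite !(cfD, cfN, cfZ) cf_scal hu hv; case: eqP => [->|/eqP hj0].
  rewrite dsv dtu -/H -subn1 !mulr0 subr0 addr0 -sumrB; apply: eq_bigr => k _.
  have [e1 e2 e3 e4] := small k (ltn_ord k).
  rewrite /rest_terms /T /fma_term !e1 !e2 !e3 !e4 xH yH addn0 eqxx.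
  have -> : (H == k + 1)%N = false by have := ltn_ord k; lia.
  have -> : (H == H + (k + 1))%N = false by lia.
  by ring.
pose F k := cf (X.1 : cd K m) k * cf (Y.2 : cd K m) 0 - cf (X.2 : cd K m) 0 * cf (Y.1 : cd K m) k.
transitivity (\sum_(k < H - 1) (if j == k.+1 then F k.+1 else 0)).
  apply: eq_bigr => k _; have [e1 e2 e3 e4] := small k (ltn_ord k).
  rewrite /rest_terms /T /fma_term !e1 !e2 !e3 !e4 xH yH eqn_add2l addn1.
  have -> : (H + j == H)%N = false by lia.
  have -> : (H + j == k.+1)%N = false by have := ltn_ord k; lia.
  by case: eqP => _; rewrite /F; ring.
rewrite sum_delta /F; have -> : (0 < j <= H - 1)%N by lia.
by ring.
Qed.

Section AddRest.
Variables (R : realType) (view : (nat -> R) -> nat -> nat -> K).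
Variable fma : bool -> iexp -> iexp -> iexp -> cmd R.
Variables (m x y z w L : nat) (X Y : cd K m.+1).
Let ins := inputs view m.+1 x y (cf X) (cf Y).
Hypothesis view_keeps : forall g g', keeps z w L g g' -> ins g -> ins g'.
Hypothesis fma_ok : fma_correct view fma m.+1 x y z w L (cf X) (cf Y).

Lemma add_rest_correct :
  adds view m.+1 x y z w L (cf X) (cf Y)
    [:: m.+1; x; y; z; w] (add_rest fma) (cf (cross_rest X Y)).
Proof.
have eH i : ieval [:: m.+1; x; y; z; w; i] hdim = (2 ^ m)%N by rewrite /= subn1.
have e2 : (2 ^ m.+1 = 2 * 2 ^ m)%N by rewrite expnS.
have H0 : (0 < 2 ^ m)%N by rewrite expn_gt0.
have hs := adds_seq view_keeps; rewrite /add_rest.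
set body := (X in For _ X).
have hbody i : (i < 2 ^ m - 1)%N -> adds view m.+1 x y z w L (cf X) (cf Y)
    [:: m.+1; x; y; z; w; i] body (rest_terms (fma_term (cf X) (cf Y)) (2 ^ m) i).
  move=> hi; rewrite -(eH i).
  do 5! (apply: (hs);
    first by apply: fma_ok; [exists [:: i] | rewrite ?eH /= ?subn1 /= e2; lia ..]).
  by apply: fma_ok; [exists [:: i] | rewrite ?eH /= ?subn1 /= e2; lia ..].
have := adds_for view_keeps (e := ISub hdim (INat 1)) (env := [:: m.+1; x; y; z; w]).
rewrite [ieval _ _]/= subSS subn0 => hfor g hg.
have [k v] := hfor _ _ hbody g hg; split=> // j hj.
by rewrite v // cross_rest_sum.
Qed.

End AddRest.
End Rest.

(** * Loops that prepare operands and combine results *)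

Section Loops.
Variable R : realType.
Implicit Types (g h : nat -> R).

Definition extends (e : iexp) (env : seq nat) (a : nat) :=
  ieval env e = a /\ forall i, ieval (rcons env i) e = a.

Lemma run_copy_but n x y z w src dst len k g s d l k0 :
  let env := [:: n; x; y; z; w] in
  extends src env s -> extends dst env d -> ieval env len = l -> ieval env k = k0 ->
  (k0 < l)%N -> (s + l <= d)%N ->
  let g' := run env (copy_but R src dst len k) g in
  (forall i, (i < l)%N -> g' (d + i)%N = if i == k0 then 0 else g (s + i)%N) /\
  (forall c, (c < d \/ d + l <= c)%N -> g' c = g c).
Proof.
move=> env [hs hs'] [hd hd'] hl hk kl sd; rewrite /copy_but run_seq run_const /= hd hk.
have loop : forall c, run env (For len (Copy _ (dst :+ idx) (src :+ idx))) g c =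
    if (d <= c < d + l)%N then g (s + (c - d))%N else g c.
  rewrite -hl; apply: (run_for (I := fun i h => forall c, h c =
    if (d <= c < d + i)%N then g (s + (c - d))%N else g c)) => [c|i h].
    by have -> : (d <= c < d + 0)%N = false by lia.
  rewrite hl => hi hI c; rewrite run_copy [ieval _ _]/= [ieval _ (src :+ _)]/=.
  rewrite -/(rcons env i) hs' hd' !hI /upd.
  have -> : (d <= s + i < d + i)%N = false by lia.
  case: eqP => [->|ne]; last first.
    by have -> : (d <= c < d + i.+1)%N = (d <= c < d + i)%N by lia.
  have -> : (d <= d + i < d + i.+1)%N by lia.
  by rewrite addKn.
split=> [i hi|c hc]; rewrite /upd loop.
  by rewrite eqn_add2l; have -> : (d <= d + i < d + l)%N by [lia]; rewrite addKn.
have -> : (c == d + k0)%N = false by lia.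
by have -> : (d <= c < d + l)%N = false by lia.
Qed.

(** The invariant describes the whole memory after k iterations; the source is
    disjoint from the destination, hence still equal to the initial memory. *)
Lemma run_twist m x y z w src dst neg g s d :
  let env := [:: m.+1; x; y; z; w] in let H := (2 ^ m)%N in
  extends src env s -> extends dst env d -> (s + 4 * H <= d)%N ->
  let g' := run env (twist R neg src dst) g in
  [/\ forall i, (i < H)%N -> g' (d + i)%N = if i == 0%N then 0 else
        arith_eval (addsub (~~ neg)) (g (s + i)%N) (g (s + (2 * H + (H + i)))%N),
      forall i, (i < H)%N -> g' (d + (H + i))%N = if i == 0%N then 0 else
        arith_eval (addsub neg) (g (s + (2 * H + i))%N) (g (s + (H + i))%N)
    & forall c, (c < d \/ d + 2 * H <= c)%N -> g' c = g c].
Proof.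
move=> env H [hs hs'] [hd hd'] sd; rewrite /twist !run_seq !run_const.
have eH : ieval env hdim = H by rewrite /= subn1.
have eH' i : ieval (rcons env i) hdim = H by rewrite /= subn1.
have eN i : ieval (rcons env i) fdim = (2 * H)%N by rewrite /= expnS.
set body := (X in For _ X).
pose I k h := forall c, h c =
  if (d <= c < d + k)%N
  then arith_eval (addsub (~~ neg)) (g (s + (c - d))%N) (g (s + (2 * H + (H + (c - d))))%N)
  else if (d + H <= c < d + H + k)%N
  then arith_eval (addsub neg) (g (s + (2 * H + (c - (d + H))))%N) (g (s + (H + (c - (d + H))))%N)
  else g c.
have loop : I H (run env (For hdim body) g).
  rewrite -[X in I X _]eH; apply: run_for => [c|i h].
    have -> : (d <= c < d + 0)%N = false by lia.
    by have -> : (d + H <= c < d + H + 0)%N = false by lia.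
  rewrite eH => hi hI c.
  have old b : (b < d)%N -> h b = g b.
    move=> hb; rewrite hI; have -> : (d <= b < d + i)%N = false by lia.
    by have -> : (d + H <= b < d + H + i)%N = false by lia.
  rewrite /body run_seq !run_arith.
  have ev e1 e2 : ieval (rcons env i) (e1 :+ e2) =
    (ieval (rcons env i) e1 + ieval (rcons env i) e2)%N by [].
  have ei : ieval (rcons env i) idx = i by [].
  rewrite !ev ei hs' hd' eH' eN; clear ev ei.
  rewrite ![upd _ _ _ (s + _)%N]upd_other; try lia.
  rewrite !old; try lia.
  rewrite /upd hI.
  case: (eqVneq c (d + (H + i))%N) => [->|n1].
    have -> : (d <= d + (H + i) < d + i.+1)%N = false by lia.
    have -> : (d + H <= d + (H + i) < d + H + i.+1)%N by lia.
    by have -> : (d + (H + i) - (d + H) = i)%N by lia.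
  case: (eqVneq c (d + i)%N) => [->|n2].
    have -> : (d <= d + i < d + i.+1)%N by lia.
    by rewrite addKn.
  have -> : (d <= c < d + i.+1)%N = (d <= c < d + i)%N by lia.
  by have -> : (d + H <= c < d + H + i.+1)%N = (d + H <= c < d + H + i)%N by lia.
have -> : ieval env (dst :+ hdim) = (d + H)%N by rewrite -hd -eH.
rewrite hd; move: loop; set f := run env _ g; clearbody f => loop.
split=> [i hi|i hi|c hc]; rewrite /upd loop.
- have -> : (d + i == d + H)%N = false by lia.
  rewrite -[X in _ == X]addn0 eqn_add2l.
  by have -> : (d <= d + i < d + H)%N by [lia]; rewrite addKn.
- rewrite -[X in _ == X]addn0 addnA eqn_add2l.
  have -> : (d + H + i == d)%N = (i == 0%N) && (H == 0%N) by lia.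
  have -> : (d <= d + H + i < d + H)%N = false by lia.
  have -> : (d + H <= d + H + i < d + H + H)%N by lia.
  by rewrite addKn; case: (i == 0%N); case: (H == 0%N).
- have -> : (c == d + H)%N = false by have := expn_gt0 2 m; rewrite -/H; lia.
  have -> : (c == d)%N = false by have := expn_gt0 2 m; rewrite -/H; lia.
  have -> : (d <= c < d + H)%N = false by lia.
  by have -> : (d + H <= c < d + H + H)%N = false by lia.
Qed.
Lemma run_zero n x y z w e l g :
  let env := [:: n; x; y; z; w] in ieval env e = l ->
  let g' := run env (For e (Const (res :+ idx) 0)) g in
  (forall i, (i < l)%N -> g' (z + i)%N = 0) /\
  (forall c, (c < z \/ z + l <= c)%N -> g' c = g c).
Proof.
move=> env hl g'.
have loop : forall c, g' c = if (z <= c < z + l)%N then 0 else g c.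
  rewrite -hl; apply: (run_for (I := fun i h => forall c, h c =
    if (z <= c < z + i)%N then 0 else g c)) => [c|i h].
    by have -> : (z <= c < z + 0)%N = false by lia.
  rewrite hl => hi hI c; rewrite run_const /upd hI /=.
  case: eqP => [->|ne]; first by have -> : (z <= z + i < z + i.+1)%N by lia.
  by have -> : (z <= c < z + i.+1)%N = (z <= c < z + i)%N by lia.
split=> [i hi|c hc]; rewrite loop; first by have -> : (z <= z + i < z + l)%N by lia.
by have -> : (z <= c < z + l)%N = false by lia.
Qed.

Lemma run_negate m x y z w g :
  let env := [:: m.+1; x; y; z; w] in let H := (2 ^ m)%N in
  let g' := run env (For hdim (Scale (res :+ (hdim :+ idx)) (-1) (res :+ (hdim :+ idx)))) g in
  (forall i, (i < H)%N -> g' (z + (H + i))%N = - g (z + (H + i))%N) /\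
  (forall c, (c < z + H \/ z + H + H <= c)%N -> g' c = g c).
Proof.
move=> env H g'.
have eH : ieval env hdim = H by rewrite /= subn1.
pose I k h := forall c, h c = if (z + H <= c < z + H + k)%N then - g c else g c.
have loop : I H g'.
  rewrite -[X in I X _]eH; apply: run_for => [c|i h].
    by have -> : (z + H <= c < z + H + 0)%N = false by lia.
  rewrite eH => hi hI c; rewrite run_scale.
  have -> : ieval (rcons env i) (res :+ (hdim :+ idx)) = (z + H + i)%N.
    by rewrite /= subn1 addnA.
  rewrite /upd !hI; have -> : (z + H <= z + H + i < z + H + i)%N = false by lia.
  case: eqP => [->|ne]; last first.
    by have -> : (z + H <= c < z + H + i.+1)%N = (z + H <= c < z + H + i)%N by lia.
  have -> : (z + H <= z + H + i < z + H + i.+1)%N by lia.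
  by rewrite mulN1r.
split=> [i hi|c hc]; rewrite loop.
  by have -> : (z + H <= z + (H + i) < z + H + H)%N by lia.
by have -> : (z + H <= c < z + H + H)%N = false by lia.
Qed.

(** The differences go to registers before their operands are overwritten. *)
Lemma combine_registers (g : nat -> R) (a b c d p q : nat) :
    (a < b < c)%N -> (c < d < p)%N -> (p < q)%N ->
  let g1 := upd g p (g a - g c) in
  let g2 := upd g1 q (g1 d - g1 b) in
  let g3 := upd g2 a (g2 a + g2 c) in
  let g4 := upd g3 c (g3 b + g3 d) in
  let g5 := upd g4 a (2^-1 * g4 a) in
  let g6 := upd g5 b (2^-1 * g5 q) in
  let g7 := upd g6 c (2^-1 * g6 c) in
  let g8 := upd g7 d (2^-1 * g7 p) in
  [/\ g8 a = 2^-1 * (g a + g c), g8 b = 2^-1 * (g d - g b),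
      g8 c = 2^-1 * (g b + g d), g8 d = 2^-1 * (g a - g c)
    & forall e, e <> a -> e <> b -> e <> c -> e <> d -> (e < p)%N -> g8 e = g e].
Proof.
move=> h1 h2 h3 g1 g2.
have l2 e : (e < p)%N -> g2 e = g e by move=> h; rewrite /g2 /g1; readm.
have q2 : g2 q = g d - g b by rewrite /g2; readm; rewrite /g1; readm.
have p2 : g2 p = g a - g c by rewrite /g2; readm; rewrite /g1; readm.
rewrite !l2; try lia.
clearbody g2; move=> g3; have b3 : g3 b = g b by rewrite /g3; readm; apply: l2; lia.
have d3 : g3 d = g d by rewrite /g3; readm; apply: l2; lia.
rewrite b3 d3 => g4; have a4 : g4 a = g a + g c by rewrite /g4 /g3; readm.
have c4 : g4 c = g b + g d by rewrite /g4; readm.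
have p4 : g4 p = g a - g c by rewrite /g4 /g3; readm.
have q4 : g4 q = g d - g b by rewrite /g4 /g3; readm.
have l4 e : e <> a -> e <> c -> (e < p)%N -> g4 e = g e.
  by move=> *; rewrite /g4 /g3; readm; apply: l2.
rewrite a4; clearbody g4; move=> g5; have q5 : g5 q = g d - g b by rewrite /g5; readm.
rewrite q5 => g6; have p6 : g6 p = g a - g c by rewrite /g6 /g5; readm.
have c6 : g6 c = g b + g d by rewrite /g6 /g5; readm.
have a6 : g6 a = 2^-1 * (g a + g c) by rewrite /g6 /g5; readm.
have b6 : g6 b = 2^-1 * (g d - g b) by rewrite /g6; readm.
have l6 e : e <> a -> e <> b -> e <> c -> (e < p)%N -> g6 e = g e.
  by move=> *; rewrite /g6 /g5; readm; apply: l4.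
rewrite c6; clearbody g6; move=> g7; have p7 : g7 p = g a - g c by rewrite /g7; readm.
rewrite p7 /=; split.
- by rewrite /g7; readm.
- by rewrite /g7; readm.
- by rewrite /g7; readm.
- by readm.
- by move=> *; rewrite /g7; readm; apply: l6.
Qed.

(** Iteration i reads and writes the same four cells, so cells with an index at
    least k still have their initial values after k iterations. *)
Lemma run_combine m x y z w g :
  let env := [:: m.+1; x; y; z; w] in let H := (2 ^ m)%N in
  (z + 4 * H <= w)%N ->
  let g' := run env (combine R) g in
  (forall i, (i < H)%N ->
     [/\ g' (z + i)%N = 2^-1 * (g (z + i)%N + g (z + (2 * H + i))%N),
         g' (z + (H + i))%N = 2^-1 * (g (z + (2 * H + (H + i)))%N - g (z + (H + i))%N),
         g' (z + (2 * H + i))%N = 2^-1 * (g (z + (H + i))%N + g (z + (2 * H + (H + i)))%N)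
       & g' (z + (2 * H + (H + i)))%N = 2^-1 * (g (z + i)%N - g (z + (2 * H + i))%N)]) /\
  (forall c, (c < w)%N -> (c < z \/ z + 4 * H <= c)%N -> g' c = g c).
Proof.
move=> env H zw g'.
have eH : ieval env hdim = H by rewrite /= subn1.
pose old h i := [/\ h (z + i)%N = g (z + i)%N, h (z + (H + i))%N = g (z + (H + i))%N,
  h (z + (2 * H + i))%N = g (z + (2 * H + i))%N &
  h (z + (2 * H + (H + i)))%N = g (z + (2 * H + (H + i)))%N].
pose new h i :=
  [/\ h (z + i)%N = 2^-1 * (g (z + i)%N + g (z + (2 * H + i))%N),
      h (z + (H + i))%N = 2^-1 * (g (z + (2 * H + (H + i)))%N - g (z + (H + i))%N),
      h (z + (2 * H + i))%N = 2^-1 * (g (z + (H + i))%N + g (z + (2 * H + (H + i)))%N)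
    & h (z + (2 * H + (H + i)))%N = 2^-1 * (g (z + i)%N - g (z + (2 * H + i))%N)].
pose I k h := [/\ forall i, (i < k)%N -> new h i, forall i, (k <= i < H)%N -> old h i
  & forall c, (c < w)%N -> (c < z \/ z + 4 * H <= c)%N -> h c = g c].
suff [h1 _ h2] : I H g' by split.
rewrite -[X in I X _]eH; apply: run_for => [|k h]; first by split.
rewrite eH => hk [hnew hold hout].
have [ha hb hc hd] := hold k ltac:(lia).
have [] := @combine_registers h (z + k) (z + (H + k)) (z + (2 * H + k))
  (z + (2 * H + (H + k))) w (w + 1) ltac:(lia) ltac:(lia) ltac:(lia).
rewrite !run_seq !run_arith !run_scale.
have ev e1 e2 : ieval (rcons env k) (e1 :+ e2) =
  (ieval (rcons env k) e1 + ieval (rcons env k) e2)%N by [].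
have eH' : ieval (rcons env k) hdim = H by rewrite /= subn1.
have eN : ieval (rcons env k) fdim = (2 * H)%N by rewrite /= expnS.
have ei : ieval (rcons env k) idx = k by [].
have er : ieval (rcons env k) res = z by [].
have ew : ieval (rcons env k) wsp = w by [].
have e1 : ieval (rcons env k) (INat 1) = 1%N by [].
rewrite !(ev, eH', eN, ei, er, ew, e1) [arith_eval Add]/= [arith_eval Defs.Sub]/=.
set h' := upd _ (z + (2 * H + (H + k)))%N _; clearbody h'; rewrite ha hb hc hd => pa pb pc pd pe.
split=> [i hi|i hi|c hcw hcz].
- case: (eqVneq i k) => [->|ik]; first by split.
  have [na nb nc nd] := hnew i ltac:(lia).
  by split; rewrite pe ?na ?nb ?nc ?nd //; lia.
- have [na nb nc nd] := hold i ltac:(lia).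
  by split; rewrite pe ?na ?nb ?nc ?nd //; lia.
- by rewrite pe; [apply: hout | lia..].
Qed.

End Loops.

(** * Procedure C *)

Section Specs.
Variable R : realType.
Local Notation C := R[i].
Implicit Types (g : nat -> R).
Let P := cd_program R.

Definition subcalls (t : calltree R) : seq (calltree R) :=
  let: CallNode _ _ _ _ _ ts := t in ts.

Definition storedC n g a (X : cd C n) := forall i, (i < 2 ^ n)%N -> viewC n g a i = cf X i.
Definition storedR n g a (X : cd R n) := forall i, (i < 2 ^ n)%N -> viewR g a i = cf X i.

Lemma slice_storedC n g S a (X : cd C n) : storedC g a X -> (a + 2 * 2 ^ n <= S)%N ->
  slice (mkseq g S) a (2 * 2 ^ n)%N = ccoeffs X.
Proof.
move=> h ha; apply: (@eq_from_nth _ 0) => [|i].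
  by rewrite /ccoeffs size_cat !size_coeffs /slice size_take size_drop size_mkseq; case: ltnP; lia.
rewrite /slice size_take size_drop size_mkseq => hi.
have {}hi : (i < 2 * 2 ^ n)%N by move: hi; case: ifP; lia.
rewrite nth_take // nth_drop nth_mkseq; last by lia.
rewrite /ccoeffs nth_cat size_coeffs; case: ltnP => hi2.
  by rewrite -/(cf (cdRec X) i) cf_Rec -h.
rewrite -/(cf (cdImc X) (i - 2 ^ n)) cf_Imc -h /=; last by lia.
by congr (g _); lia.
Qed.

Lemma slice_storedR n g S a (X : cd R n) : storedR g a X -> (a + 2 ^ n <= S)%N ->
  slice (mkseq g S) a (2 ^ n)%N = coeffs X.
Proof.
move=> h ha; apply: (@eq_from_nth _ 0) => [|i].
  by rewrite size_coeffs /slice size_take size_drop size_mkseq; case: ltnP; lia.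
rewrite /slice size_take size_drop size_mkseq => hi.
have {}hi : (i < 2 ^ n)%N by move: hi; case: ifP; lia.
rewrite nth_take // nth_drop nth_mkseq; last by lia.
by rewrite -/(cf X i) -h.
Qed.

Lemma storedC_eq n g g' a (X : cd C n) : storedC g a X ->
  (forall i, (i < 2 * 2 ^ n)%N -> g' (a + i)%N = g (a + i)%N) -> storedC g' a X.
Proof. by move=> h e i hi; rewrite -(h i hi) /viewC !e //; lia. Qed.

Lemma storedR_eq n g g' a (X : cd R n) : storedR g a X ->
  (forall i, (i < 2 ^ n)%N -> g' (a + i)%N = g (a + i)%N) -> storedR g' a X.
Proof. by move=> h e i hi; rewrite -(h i hi) /viewR !e. Qed.

Lemma complex_inv2 : (2^-1 : C) = Complex 2^-1 0.
Proof. by rewrite -[RHS]/(real_complex R 2^-1) fmorphV rmorph_nat. Qed.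

Definition twisted (neg : bool) n (u s : cd C n) : cd C n :=
  if neg then u - im_unit R *: s else u + im_unit R *: s.

(** At coordinate 0, the loop of twist produces a combination with g, and erasing
    it is correct because u and s are imaginary. *)
Lemma twist_stored m x y z w src dst neg g s d (X : cd C m.+1) :
  let env := [:: m.+1; x; y; z; w] in
  extends src env s -> extends dst env d -> (s + 4 * 2 ^ m <= d)%N ->
  imag X -> storedC g s X ->
  let g' := run env (twist R neg src dst) g in
  storedC g' d (twisted neg (X.1 : cd C m) (cdIm (X.2 : cd C m))) /\
  (forall c, (c < d \/ d + 2 * 2 ^ m <= c)%N -> g' c = g c).
Proof.
move=> env hs hd sd hX hg g'.
have [h1 h2 h3] := run_twist neg g hs hd sd; split=> // i hi.
rewrite /viewC /g' h1 // h2 //; clear h1 h2 h3 g'.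
have hI := cf_Im (two_neq0_complex R) (X.2 : cd C m) i; move: hI.
move: (cdIm (X.2 : cd C m)) => s' hI.
have -> : cf (twisted neg (X.1 : cd C m) s') i =
    (if neg then cf (X.1 : cd C m) i - im_unit R * cf s' i
     else cf (X.1 : cd C m) i + im_unit R * cf s' i).
  by rewrite /twisted; case: neg; rewrite cfD ?cfN cfZ.
rewrite hI; have e2 : (2 ^ m.+1 = 2 * 2 ^ m)%N by rewrite expnS.
case: eqP => [->|/eqP i0].
  by have := imag_fst hX; rewrite /imag => ->; rewrite mulr0 subr0 addr0; case: neg.
have := hg (2 ^ m + i)%N; rewrite cf_snd => /(_ ltac:(lia)) <-.
have := hg i; rewrite cf_fst // => /(_ ltac:(lia)) <-.
rewrite /viewC e2; apply: complex_ext; case: neg;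
  rewrite ?cReD ?cImD ?cReN ?cImN ?cReM ?cImM /=; ring.
Qed.

(** Four registers, two buffers for complex operands of level n - 1, then the
    workspace of the calls: the sum of all levels is O(2^n), by workspace_le. *)
Fixpoint workspace n := if n is m.+1 then (4 + 2 * 2 ^ n + workspace m)%N else 0%N.

(** The result area precedes the operands, and the workspace follows them: a
    callee may then overwrite its result area and everything from w on. *)
Definition layout L z x y w s v :=
  [/\ z + L <= x, z + L <= y, x + L <= w, y + L <= w & w + v <= s]%N.

(** With H = 2^(n-1), an activation makes 8 H operations to build the operands of
    its calls, 8 H to combine their results and less than 60 H in the loop of
    multiply-adds, that is less than 80 H = 40 * 2^n. *)
Definition specC n := forall s x y z w g (X Y : cd C n), imag X -> imag Y ->
  layout (2 * 2 ^ n)%N z x y w s (workspace n) -> storedC g x X -> storedC g y Y ->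
  exists g' k, [/\ exec P [:: n; x; y; z; w] (P AlgC) (mkseq g s) (mkseq g' s) k
      (3 * cross_count n) (subcalls (treeC X Y)), (k <= 40 * n * 2 ^ n)%N,
    storedC g' z (algC X Y) & keeps z w (2 * 2 ^ n)%N g g'].

(** A call records the stored operands and result: they determine the node of the
    call tree. *)
Lemma call_C n env en ex ey ez ew s x y z w g (X Y : cd C n) :
  specC n -> ieval env en = n -> ieval env ex = x -> ieval env ey = y ->
  ieval env ez = z -> ieval env ew = w -> imag X -> imag Y ->
  layout (2 * 2 ^ n)%N z x y w s (workspace n) -> storedC g x X -> storedC g y Y ->
  exists g' k, [/\ exec P env (Call R AlgC en ex ey ez ew) (mkseq g s) (mkseq g' s) k
      (3 * cross_count n) [:: treeC X Y], (k <= 40 * n * 2 ^ n)%N,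
    storedC g' z (algC X Y) & keeps z w (2 * 2 ^ n)%N g g'].
Proof.
move=> hn en' ex' ey' ez' ew' hX hY hl sx sy.
have [g' [k [hx hk sz kp]]] := hn _ _ _ _ _ g X Y hX hY hl sx sy.
exists g', k; split=> //.
have -> : treeC X Y = CallNode AlgC n (slice (mkseq g s) x (2 * 2 ^ n)%N)
    (slice (mkseq g s) y (2 * 2 ^ n)%N) (slice (mkseq g' s) z (2 * 2 ^ n)%N)
    (subcalls (treeC X Y)).
  case: hl => *; rewrite (slice_storedC sx) ?(slice_storedC sy) ?(slice_storedC sz); try lia.
  by case: (n) X Y {hn hX hY sx sy hx sz hk kp}.
have hc := @ECall R P env AlgC en ex ey ez ew (mkseq g s) (mkseq g' s) k
  (3 * cross_count n) (subcalls (treeC X Y)).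
by cbv zeta in hc; rewrite en' ex' ey' ez' ew' in hc; exact: hc.
Qed.

Lemma ops_twist env neg src dst : ops env (twist R neg src dst) = (2 * ieval env hdim)%N.
Proof. by rewrite /= sum_nat_const card_ord !addn0 mulnC. Qed.

Lemma prods_twist env neg src dst : prods env (twist R neg src dst) = 0%N.
Proof. by case: neg; rewrite /= big1. Qed.

Lemma ops_combine env : ops env (combine R) = (8 * ieval env hdim)%N.
Proof. by rewrite /= sum_nat_const card_ord mulnC. Qed.

Lemma prods_combine env : prods env (combine R) = 0%N.
Proof. by rewrite /= big1. Qed.

Lemma ops_add_restC env : ops env (add_rest (@fmaC R)) = (60 * (ieval env hdim - 1))%N.
Proof. by rewrite /= sum_nat_const card_ord mulnC. Qed.

Lemma prods_add_restC env : prods env (add_rest (@fmaC R)) = (18 * (ieval env hdim - 1))%N.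
Proof. by rewrite /= sum_nat_const card_ord mulnC. Qed.

Lemma ops_add_restR env : ops env (add_rest (@fmaR R)) = (12 * (ieval env hdim - 1))%N.
Proof. by rewrite /= sum_nat_const card_ord mulnC. Qed.

Lemma prods_add_restR env : prods env (add_rest (@fmaR R)) = (6 * (ieval env hdim - 1))%N.
Proof. by rewrite /= sum_nat_const card_ord mulnC. Qed.

Lemma cross_count_small n : (n <= 1)%N -> cross_count n = 0%N.
Proof. by case: n => [|[|]]. Qed.

Lemma algC_small n (X Y : cd C n) : (n <= 1)%N -> algC X Y = 0.
Proof. by case: n X Y => [|[|]]. Qed.

Lemma subcalls_small n (X Y : cd C n) : (n <= 1)%N -> subcalls (treeC X Y) = [::].
Proof. by case: n X Y => [|[|]]. Qed.

Lemma safe_twist m x y z w src dst neg s sa d :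
  let env := [:: m.+1; x; y; z; w] in
  extends src env sa -> extends dst env d -> (sa + 4 * 2 ^ m <= s)%N ->
  (d + 2 * 2 ^ m <= s)%N -> safe env s (twist R neg src dst).
Proof.
move=> env [hs hs'] [hd hd'] h1 h2; have H0 : (0 < 2 ^ m)%N by rewrite expn_gt0.
rewrite /= hd subn1 /=.
split; last by lia.
move=> i hi; rewrite -/(rcons env i) hs' hd' expnS; do !split; lia.
Qed.

Lemma safe_combine m x y z w s : (z + 4 * 2 ^ m <= w)%N -> (w + 4 <= s)%N ->
  safe [:: m.+1; x; y; z; w] s (combine R).
Proof.
move=> h1 h2; rewrite /= !subn1 /= expnS; move: (2 ^ m)%N h1 => H h1 i hi.
do !split; lia.
Qed.

Lemma safe_add_restC m x y z w s : (x + 4 * 2 ^ m <= s)%N -> (y + 4 * 2 ^ m <= s)%N ->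
  (z + 4 * 2 ^ m <= s)%N -> (w + 4 <= s)%N ->
  safe [:: m.+1; x; y; z; w] s (add_rest (@fmaC R)).
Proof.
move=> h1 h2 h3 h4; rewrite /= !subn1 /= expnS; move: (2 ^ m)%N h1 h2 h3 => H h1 h2 h3 i hi.
do !split; lia.
Qed.

Lemma safe_add_restR m x y z w s : (x + 2 * 2 ^ m <= s)%N -> (y + 2 * 2 ^ m <= s)%N ->
  (z + 2 * 2 ^ m <= s)%N -> (w < s)%N ->
  safe [:: m.+1; x; y; z; w] s (add_rest (@fmaR R)).
Proof.
move=> h1 h2 h3 h4; rewrite /= !subn1 /=; move: (2 ^ m)%N h1 h2 h3 => H h1 h2 h3 i hi.
do !split; lia.
Qed.

(** C_0 and C_1 return 0, and the program clears the output. *)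
Lemma exec_C_base n : (n <= 1)%N -> specC n.
Proof.
move=> n1 s x y z w g X Y hX hY [zx zy xw yw ws] sx sy.
pose env := [:: n; x; y; z; w].
have hs : safe env s (procC R).
  rewrite /procC /= n1 => i hi; move: n1 hi.
  by case: n {X Y hX hY sx sy env} zx zy xw yw ws => [|[|//]] /=; lia.
have he := exec_run P g hs.
have [h1 h2] := @run_zero R n x y z w (fdim :+ fdim) _ g (erefl _).
have er : run env (procC R) g = run env (For (fdim :+ fdim) (Const (res :+ idx) 0)) g.
  by rewrite /procC run_ifle [ieval env lev]/= [ieval env (INat 1)]/= n1.
have eo : ops env (procC R) = 0%N by rewrite /= n1 big1.
have ep : prods env (procC R) = (3 * cross_count n)%N.
  by rewrite cross_count_small //= n1 big1.
rewrite eo ep in he; exists (run env (procC R) g), 0%N; split=> //.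
- by rewrite subcalls_small.
- move=> i hi; rewrite /viewC er !h1 /=; try lia.
  by rewrite algC_small // cf0.
- move=> c; rewrite /outside => hc; rewrite er h2 //=; lia.
Qed.

Lemma exec_C n : specC n.
Proof.
elim: n => [|[_|m IH]]; try exact: exec_C_base.
move=> s x y z w g X Y hX hY [zx zy xw yw ws] sx sy.
set env := [:: m.+2; x; y; z; w].
set H := (2 ^ m.+1)%N; have eN : (2 ^ m.+2 = 2 * H)%N by rewrite expnS.
have H0 : (0 < H)%N by rewrite expn_gt0.
have eH : ieval env hdim = H by [].
pose A := (w + 4)%N; pose B := (A + 2 * H)%N; pose W := (B + 2 * H)%N.
have ews : workspace m.+2 = (4 + 2 * (2 * H) + workspace m.+1)%N by rewrite -eN.
rewrite eN ews in zx zy xw yw ws.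
have eA : extends (wsp :+ INat 4) env A by split.
have eB : extends (wsp :+ INat 4 :+ fdim) env B.
  by rewrite /extends /= expnS; split.
have eW : ieval env (wsp :+ INat 4 :+ fdim :+ fdim) = W.
  by rewrite /= expnS.
have ex : extends opx env x by split.
have ey : extends opy env y by split.
pose u : cd C m.+1 := X.1; pose t1 : cd C m.+1 := X.2; pose p := cdIm t1.
pose v : cd C m.+1 := Y.1; pose t2 : cd C m.+1 := Y.2; pose q := cdIm t2.
have two := two_neq0_complex R.
have imag_twisted neg a b : imag a -> imag b -> imag (twisted neg (a : cd C m.+1) b).
  move=> ha hb; rewrite /twisted; case: neg; last by apply: imagD => //; apply: imagZ.
  by rewrite -scaleNr; apply: imagD => //; apply: imagZ.
have hu : imag u by exact: imag_fst. have hv : imag v by exact: imag_fst.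
have hp : imag p by exact: imag_Im. have hq : imag q by exact: imag_Im.
pose tw neg src dst := twist R neg src dst.
pose eAx := wsp :+ INat 4; pose eBx := eAx :+ fdim.
pose g1 := run env (tw false opx eAx) g.
have [s1 k1] : storedC g1 A (twisted false u p) /\
    forall c, (c < A \/ A + 2 * H <= c)%N -> g1 c = g c.
  by exact: (twist_stored false ex eA ltac:(lia) hX sx).
have sy1 : storedC g1 y Y by apply: (storedC_eq sy) => i hi; apply: k1; lia.
pose g2 := run env (tw false opy eBx) g1.
have [s2 k2] : storedC g2 B (twisted false v q) /\
    forall c, (c < B \/ B + 2 * H <= c)%N -> g2 c = g1 c.
  by exact: (twist_stored false ey eB ltac:(lia) hY sy1).
have s12 : storedC g2 A (twisted false u p).
  by apply: (storedC_eq s1) => i hi; apply: k2; lia.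
have lay1 : layout (2 * H) z A B W s (workspace m.+1) by split; lia.
have [g3 [c3 [x3 b3 z3 f3]]] := call_C (ez := res) IH (erefl (ieval env (ISub lev (INat 1))))
  (erefl : ieval env eAx = A) (eB.1 : ieval env eBx = B) (erefl : ieval env res = z) eW
  (imag_twisted false _ _ hu hp) (imag_twisted false _ _ hv hq) lay1 s12 s2.
have k3 c : (z + 2 * H <= c < A)%N -> g3 c = g c.
  move=> hc; rewrite f3; last by rewrite /outside; lia.
  by rewrite k2 ?k1 //; lia.
(* The buffers A and B are rebuilt for the second call; the first result, at z,
   lies below every address written from here to the combination. *)
have sx3 : storedC g3 x X by apply: (storedC_eq sx) => i hi; apply: k3; lia.
have sy3 : storedC g3 y Y by apply: (storedC_eq sy) => i hi; apply: k3; lia.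
pose g4 := run env (tw true opx eAx) g3.
have [s4 k4] : storedC g4 A (twisted true u p) /\
    forall c, (c < A \/ A + 2 * H <= c)%N -> g4 c = g3 c.
  by exact: (twist_stored true ex eA ltac:(lia) hX sx3).
have sy4 : storedC g4 y Y by apply: (storedC_eq sy3) => i hi; apply: k4; lia.
pose g5 := run env (tw true opy eBx) g4.
have [s5 k5] : storedC g5 B (twisted true v q) /\
    forall c, (c < B \/ B + 2 * H <= c)%N -> g5 c = g4 c.
  by exact: (twist_stored true ey eB ltac:(lia) hY sy4).
have s45 : storedC g5 A (twisted true u p).
  by apply: (storedC_eq s4) => i hi; apply: k5; lia.
have lay2 : layout (2 * H) (z + 2 * H) A B W s (workspace m.+1) by split; lia.
have ezN : ieval env (res :+ fdim) = (z + 2 * H)%N by rewrite /= expnS.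
have [g6 [c6 [x6 b6 z6 f6]]] := call_C IH (erefl (ieval env (ISub lev (INat 1))))
  (erefl : ieval env eAx = A) (eB.1 : ieval env eBx = B) ezN eW
  (imag_twisted true _ _ hu hp) (imag_twisted true _ _ hv hq) lay2 s45 s5.
have k6 c : (c < A)%N -> (c < z + 2 * H \/ z + 2 * H + 2 * H <= c)%N -> g6 c = g3 c.
  move=> h1 h2; rewrite f6; last by rewrite /outside; lia.
  by rewrite k5 ?k4 //; lia.
have z36 : storedC g6 z (algC (twisted false u p) (twisted false v q)).
  by apply: (storedC_eq z3) => i hi; apply: k6; lia.
have [h7 k7] := @run_combine R m.+1 x y z w g6 ltac:(lia).
set g7 := run _ _ g6 in h7 k7; rewrite -/H in h7 k7.
pose base : cd C m.+2 := let Zp := algC (twisted false u p) (twisted false v q) in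
  let Zm := algC (twisted true u p) (twisted true v q) in
  (2^-1 *: (Zp + Zm), (im_unit R / 2) *: (Zp - Zm)).
have s7 : storedC g7 z base.
  move=> i hi; rewrite /viewC eN cf_pair -/H /base /=.
  case: ltnP => hiH.
    have [e1 _ e3 _] := h7 i hiH; rewrite e1 e3 cfZ cfD -(z36 i hiH) -(z6 i hiH) /viewC -/H.
    by rewrite complex_inv2 !addnA; apply: complex_ext;
      rewrite ?(cReM, cImM, cReD, cImD) /=; ring.
  have [j ej hj] : exists2 j, i = (H + j)%N & (j < H)%N by exists (i - H)%N; lia.
  rewrite {}ej in hi hiH *; have [_ e2 _ e4] := h7 j hj.
  rewrite addKn e2 e4 cfZ cfD cfN -(z36 j hj) -(z6 j hj) /viewC -/H.
  by rewrite complex_inv2 /im_unit !addnA; apply: complex_ext;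
    rewrite ?(cReM, cImM, cReD, cImD, cReN, cImN) /=; ring.
have ox i : (i < 2 * 2 ^ m.+2)%N -> outside z (2 * 2 ^ m.+2) w (x + i).
  by rewrite /outside eN; lia.
have oy i : (i < 2 * 2 ^ m.+2)%N -> outside z (2 * 2 ^ m.+2) w (y + i).
  by rewrite /outside eN; lia.
have ow : (z + 2 * 2 ^ m.+2 <= w)%N by rewrite eN; lia.
have k76 c : (z + 2 * (2 * H) <= c < w)%N -> g7 c = g c.
  move=> hc; rewrite k7 ?k6 ?k3 //; lia.
have in7 : inputs (viewC m.+2) m.+2 x y (cf X) (cf Y) g7.
  move=> i hi; split; first by apply: (storedC_eq sx) => // l hl; apply: k76; lia.
  by apply: (storedC_eq sy) => // l hl; apply: k76; lia.
have [k8 v8] := add_rest_correct two (viewC_keeps (xi := cf X) (eta := cf Y) ox oy)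
  (fmaC_correct (xi := cf X) (eta := cf Y) ox oy ow) in7.
set g8 := run _ _ g7 in k8 v8.
have ep : (3 * cross_count m.+2 = 0 + (0 + (3 * cross_count m.+1 + (0 + (0 +
    (3 * cross_count m.+1 + (0 + 18 * (H - 1))))))))%N.
  rewrite -[cross_count m.+2]/(2 * cross_count m.+1 + 6 * (2 ^ m.+1).-1)%N -/H; lia.
have etw neg src dst sa d g0 (h1 : extends src env sa) (h2 : extends dst env d) :
    (sa + 4 * H <= s)%N -> (d + 2 * H <= s)%N ->
    exec P env (tw neg src dst) (mkseq g0 s) (mkseq (run env (tw neg src dst) g0) s)
      (2 * H) 0 [::].
  move=> a b; have := exec_run P g0 (safe_twist neg h1 h2 a b).
  by rewrite ops_twist prods_twist.
have e1 := etw false _ _ _ _ g ex eA ltac:(lia) ltac:(lia).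
have e2 := etw false _ _ _ _ g1 ey eB ltac:(lia) ltac:(lia).
have e4 := etw true _ _ _ _ g3 ex eA ltac:(lia) ltac:(lia).
have e5 := etw true _ _ _ _ g4 ey eB ltac:(lia) ltac:(lia).
have e7 := exec_run P g6 (@safe_combine m.+1 x y z w s ltac:(lia) ltac:(lia)).
have e8 := exec_run P g7 (@safe_add_restC m.+1 x y z w s
  ltac:(lia) ltac:(lia) ltac:(lia) ltac:(lia)).
rewrite ops_combine prods_combine in e7; rewrite ops_add_restC prods_add_restC in e8.
have he := ESeq (e1 : exec _ _ _ _ (mkseq g1 s) _ _ _)
  (ESeq (e2 : exec _ _ _ _ (mkseq g2 s) _ _ _) (ESeq x3
  (ESeq (e4 : exec _ _ _ _ (mkseq g4 s) _ _ _)
  (ESeq (e5 : exec _ _ _ _ (mkseq g5 s) _ _ _) (ESeq x6 (ESeq e7 e8)))))).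
eexists g8, _; split.
- by rewrite ep; apply: EIfLe; exact: he.
- move: b3 b6; rewrite eH eN -/H; lia.
- move=> i hi; rewrite v8 // s7 // algC_rest // [RHS]cfD //.
- move=> c hc; rewrite k8 //; move: hc; rewrite /outside eN => hc.
  by rewrite k7 ?k6 ?f3 ?k2 ?k1 /outside //; lia.
Qed.

End Specs.

(** * Procedure R *)

Section RealSpecs.
Variable R : realType.
Local Notation C := R[i].
Implicit Types (g : nat -> R).
Let P := cd_program R.

Lemma ops_copy_but env src dst len k : ops env (copy_but R src dst len k) = 0%N.
Proof. by rewrite /= big1. Qed.

Lemma prods_copy_but env src dst len k : prods env (copy_but R src dst len k) = 0%N.
Proof. by rewrite /= big1. Qed.

Lemma safe_copy_but n x y z w src dst len k s a d l :
  let env := [:: n; x; y; z; w] in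
  extends src env a -> extends dst env d -> ieval env len = l -> (ieval env k < l)%N ->
  (a + l <= s)%N -> (d + l <= s)%N -> safe env s (copy_but R src dst len k).
Proof.
move=> env [ha ha'] [hd hd'] hl hk h1 h2; rewrite /= -/env hd hl; split; last by lia.
by move=> i hi; rewrite -/(rcons env i) ha' hd'; split; lia.
Qed.

Definition specR n := forall s x y z w g (X Y : cd R n), imag X -> imag Y ->
  layout (2 ^ n)%N z x y w s (1 + 2 * 2 ^ n + workspace n.-1) ->
  storedR g x X -> storedR g y Y ->
  exists g' k, [/\ exec P [:: n; x; y; z; w] (P AlgR) (mkseq g s) (mkseq g' s) k
      (real_cross_count n) (subcalls (treeR X Y)), (k <= 40 * n * 2 ^ n)%N,
    storedR g' z (algR X Y) & keeps z w (2 ^ n)%N g g'].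

Lemma exec_R_base : specR 1.
Proof.
move=> s x y z w g X Y hX hY [zx zy xw yw ws] sx sy.
pose env := [:: 1%N; x; y; z; w].
have hs : safe env s (procR R) by move=> i /= hi; move: zx xw ws; rewrite /=; lia.
have he := exec_run P g hs.
have [h1 h2] := @run_zero R 1 x y z w fdim _ g (erefl _).
have er : run env (procR R) g = run env (For fdim (Const (res :+ idx) 0)) g.
  by rewrite /procR run_ifle.
have eo : ops env (procR R) = 0%N by rewrite /= big1.
have ep : prods env (procR R) = real_cross_count 1 by rewrite /= big1.
rewrite eo ep in he; exists (run env (procR R) g), 0%N; split=> //.
- by move=> i hi; rewrite /viewR er h1 // cf0.
- by move=> c; rewrite /outside => hc; rewrite er h2 //=; lia.
Qed.

(** The storage of a real operand (u, g + s) with g erased is also the storage of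
    the complex operand u + i s, so no arithmetic is needed. *)
Lemma copy_stored_cplx m x y z w src dst g s d (X : cd R m.+1) :
  let env := [:: m.+1; x; y; z; w] in
  extends src env s -> extends dst env d -> (s + 2 * 2 ^ m <= d)%N ->
  imag X -> storedR g s X ->
  let g' := run env (copy_but R src dst fdim hdim) g in
  storedC g' d (cplx (X.1 : cd R m) (cdIm (X.2 : cd R m))) /\
  (forall c, (c < d \/ d + 2 * 2 ^ m <= c)%N -> g' c = g c).
Proof.
move=> env hs hd sd hX hg g'; have H0 : (0 < 2 ^ m)%N by rewrite expn_gt0.
have e2 : (2 ^ m.+1 = 2 * 2 ^ m)%N by rewrite expnS.
have eF : ieval env fdim = (2 * 2 ^ m)%N by rewrite /= e2.
have eH : ieval env hdim = (2 ^ m)%N by rewrite /= subn1.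
have [h1 h2] := run_copy_but g hs hd eF eH ltac:(lia) sd; split=> // i hi.
rewrite cf_cplx cf_Im ?two_neq0_real // /viewC /g' !h1; try lia.
have -> : (i == 2 ^ m)%N = false by lia.
rewrite -[X in _ == X]addn0 eqn_add2l.
have := hg i; rewrite cf_fst // => /(_ ltac:(lia)) <-.
by have := hg (2 ^ m + i)%N; rewrite cf_snd => /(_ ltac:(lia)) <-.
Qed.

Lemma copy_stored_Im n x y z w src dst g s d (X : cd R n) :
  let env := [:: n; x; y; z; w] in
  extends src env s -> extends dst env d -> (s + 2 ^ n <= d)%N -> storedR g s X ->
  let g' := run env (copy_but R src dst fdim (INat 0)) g in
  storedR g' d (cdIm X) /\
  (forall c, (c < d \/ d + 2 ^ n <= c)%N -> g' c = g c).
Proof.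
move=> env hs hd sd hg g'; have H0 : (0 < 2 ^ n)%N by rewrite expn_gt0.
have [h1 h2] := run_copy_but g hs hd (erefl (ieval env fdim)) (erefl (ieval env (INat 0))) H0 sd.
split=> // i hi; rewrite cf_Im ?two_neq0_real // /viewR /g' h1 //=.
by rewrite -(hg i hi).
Qed.

Lemma exec_R n : (0 < n)%N -> specR n.
Proof.
case: n => [//|[_|m _]]; first exact: exec_R_base.
move=> s x y z w g X Y hX hY [zx zy xw yw ws] sx sy.
set env := [:: m.+2; x; y; z; w].
set H := (2 ^ m.+1)%N; have eN : (2 ^ m.+2 = 2 * H)%N by rewrite expnS.
have H0 : (0 < H)%N by rewrite expn_gt0.
have eH : ieval env hdim = H by [].
have eF : ieval env fdim = (2 * H)%N by rewrite /= eN.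
pose A := (w + 1)%N; pose B := (A + 2 * H)%N; pose W := (B + 2 * H)%N.
rewrite eN [m.+2.-1]/= in zx zy xw yw ws.
pose eAx := wsp :+ INat 1; pose eBx := eAx :+ fdim; pose eWx := eBx :+ fdim.
have eA : extends eAx env A by split.
have eB : extends eBx env B by rewrite /extends /= expnS; split.
have eW : ieval env eWx = W by rewrite /= expnS.
have ex : extends opx env x by split.
have ey : extends opy env y by split.
pose u : cd R m.+1 := X.1; pose t1 : cd R m.+1 := X.2; pose p := cdIm t1.
pose v : cd R m.+1 := Y.1; pose t2 : cd R m.+1 := Y.2; pose q := cdIm t2.
have two := two_neq0_real R.
have hu : imag (cplx u p) by apply: cplx_imag; [exact: imag_fst | exact: imag_Im].
have hv : imag (cplx v q) by apply: cplx_imag; [exact: imag_fst | exact: imag_Im].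
pose cp src dst := copy_but R src dst fdim hdim.
pose g1 := run env (cp opx eAx) g.
have [s1 k1] : storedC g1 A (cplx u p) /\
    forall c, (c < A \/ A + 2 * H <= c)%N -> g1 c = g c.
  by exact: (copy_stored_cplx ex eA ltac:(lia) hX sx).
have sy1 : storedR g1 y Y by apply: (storedR_eq sy) => i hi; apply: k1; lia.
pose g2 := run env (cp opy eBx) g1.
have [s2 k2] : storedC g2 B (cplx v q) /\
    forall c, (c < B \/ B + 2 * H <= c)%N -> g2 c = g1 c.
  by exact: (copy_stored_cplx ey eB ltac:(lia) hY sy1).
have s12 : storedC g2 A (cplx u p).
  by apply: (storedC_eq s1) => i hi; apply: k2; lia.
have lay1 : layout (2 * H) z A B W s (workspace m.+1) by split; lia.
have [g3 [c3 [x3 b3 z3 f3]]] := call_C (ez := res) (@exec_C R m.+1)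
  (erefl (ieval env (ISub lev (INat 1)))) (erefl : ieval env eAx = A)
  (eB.1 : ieval env eBx = B) (erefl : ieval env res = z) eW hu hv lay1 s12 s2.
have k3 c : (c < w)%N -> (c < z \/ z + 2 * H <= c)%N -> g3 c = g c.
  move=> hc1 hc2; rewrite f3; last by rewrite /outside; lia.
  by rewrite k2 ?k1 //; lia.
have [h4 k4] := @run_negate R m.+1 x y z w g3.
set g4 := run _ _ g3 in h4 k4; rewrite -/H in h4 k4.
pose base : cd R m.+2 :=
  let Z := algC (cplx u p) (cplx v q) in (cdRec Z, - cdImc Z).
have s4 : storedR g4 z base.
  move=> i hi; rewrite /viewR cf_pair -/H /base /=.
  case: ltnP => hiH.
    by rewrite k4; [rewrite cf_Rec -(z3 i hiH) | lia].
  have [j ej hj] : exists2 j, i = (H + j)%N & (j < H)%N by exists (i - H)%N; lia.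
  rewrite {}ej in hi hiH *.
  by rewrite addKn h4 // cfN cf_Imc -(z3 j hj).
have ox i : (i < 2 ^ m.+2)%N -> outside z (2 ^ m.+2) w (x + i).
  by rewrite /outside eN; lia.
have oy i : (i < 2 ^ m.+2)%N -> outside z (2 ^ m.+2) w (y + i).
  by rewrite /outside eN; lia.
have ow : (z + 2 ^ m.+2 <= w)%N by rewrite eN; lia.
have k43 c : (z + 2 * H <= c < w)%N -> g4 c = g c.
  by move=> hc; rewrite k4 ?k3 //; lia.
have in4 : inputs (@viewR R) m.+2 x y (cf X) (cf Y) g4.
  move=> i hi; split; first by apply: (storedR_eq sx) => // l hl; apply: k43; lia.
  by apply: (storedR_eq sy) => // l hl; apply: k43; lia.
have [k5 v5] := add_rest_correct two (viewR_keeps (xi := cf X) (eta := cf Y) ox oy)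
  (fmaR_correct (xi := cf X) (eta := cf Y) ow) in4.
set g5 := run _ _ g4 in k5 v5.
have ecp src dst sa d g0 (h1 : extends src env sa) (h2 : extends dst env d) :
    (sa + 2 * H <= s)%N -> (d + 2 * H <= s)%N ->
    exec P env (cp src dst) (mkseq g0 s) (mkseq (run env (cp src dst) g0) s) 0 0 [::].
  move=> a b.
  have := exec_run P g0 (safe_copy_but (k := hdim) h1 h2 eF ltac:(rewrite eH; lia) a b).
  by rewrite ops_copy_but prods_copy_but.
have e1 := ecp _ _ _ _ g ex eA ltac:(lia) ltac:(lia).
have e2 := ecp _ _ _ _ g1 ey eB ltac:(lia) ltac:(lia).
have e4 : exec P env (For hdim (Scale (res :+ (hdim :+ idx)) (-1) (res :+ (hdim :+ idx))))
    (mkseq g3 s) (mkseq g4 s) H 0 [::].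
  have hs : safe env s (For hdim (Scale (res :+ (hdim :+ idx)) (-1 : R) (res :+ (hdim :+ idx)))).
    by rewrite /= !subn1 /= => i hi; split; lia.
  have := exec_run P g3 hs; rewrite /= sum_nat_const card_ord muln1 big1 //.
have e5 := exec_run P g4 (@safe_add_restR R m.+1 x y z w s
  ltac:(lia) ltac:(lia) ltac:(lia) ltac:(lia)).
rewrite ops_add_restR prods_add_restR in e5.
have he := ESeq (e1 : exec _ _ _ _ (mkseq g1 s) _ _ _)
  (ESeq (e2 : exec _ _ _ _ (mkseq g2 s) _ _ _) (ESeq x3 (ESeq e4 e5))).
have ep : real_cross_count m.+2 =
    (0 + (0 + (3 * cross_count m.+1 + (0 + 6 * (H - 1)))))%N.
  by rewrite -[real_cross_count m.+2]/(3 * cross_count m.+1 + 6 * (2 ^ m.+1).-1)%N -/H; lia.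
eexists g5, _; split.
- by rewrite ep; apply: EIfLe; exact: he.
- by move: b3; rewrite eH eN -/H; lia.
- by move=> i hi; rewrite v5 // (s4 i hi) algR_rest // [RHS]cfD.
- move=> c hc; rewrite k5 //; move: hc; rewrite /outside eN => hc.
  by rewrite k4 ?k3 //; lia.
Qed.

Lemma call_R n env en ex ey ez ew s x y z w g (X Y : cd R n) :
  specR n -> ieval env en = n -> ieval env ex = x -> ieval env ey = y ->
  ieval env ez = z -> ieval env ew = w -> imag X -> imag Y ->
  layout (2 ^ n)%N z x y w s (1 + 2 * 2 ^ n + workspace n.-1) ->
  storedR g x X -> storedR g y Y ->
  exists g' k, [/\ exec P env (Call R AlgR en ex ey ez ew) (mkseq g s) (mkseq g' s) k
      (real_cross_count n) [:: treeR X Y], (k <= 40 * n * 2 ^ n)%N,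
    storedR g' z (algR X Y) & keeps z w (2 ^ n)%N g g'].
Proof.
move=> hn en' ex' ey' ez' ew' hX hY hl sx sy.
have [g' [k [hx hk sz kp]]] := hn _ _ _ _ _ g X Y hX hY hl sx sy.
exists g', k; split=> //.
have -> : treeR X Y = CallNode AlgR n (slice (mkseq g s) x (2 ^ n)%N)
    (slice (mkseq g s) y (2 ^ n)%N) (slice (mkseq g' s) z (2 ^ n)%N)
    (subcalls (treeR X Y)).
  case: hl => *; rewrite (slice_storedR sx) ?(slice_storedR sy) ?(slice_storedR sz); try lia.
  by case: (n) X Y {hn hX hY sx sy hx sz hk kp}.
have hc := @ECall R P env AlgR en ex ey ez ew (mkseq g s) (mkseq g' s) k
  (real_cross_count n) (subcalls (treeR X Y)).
by cbv zeta in hc; rewrite en' ex' ey' ez' ew' in hc; exact: hc.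
Qed.

End RealSpecs.

(** * Procedure M and the theorem *)

Section Product.
Variable R : realType.
Local Notation C := R[i].
Implicit Types (g : nat -> R).
Let P := cd_program R.

(** The part of x y that involves the real part of an operand, or the real part
    of the result. *)
Definition mul_rest n (x y : cd R n) : cd R n :=
  cdscal n (cf x 0 * cf y 0 - dot (cdIm x) (cdIm y)) + cf x 0 *: cdIm y + cf y 0 *: cdIm x.

Lemma cdmul_rest n (x y : cd R n) : (0 < n)%N ->
  cdmul x y = algR (cdIm x) (cdIm y) + mul_rest x y.
Proof.
case: n x y => // n x y _; rewrite -algM_mul [RHS]addrC /mul_rest.
by rewrite -!(scalar_partE (two_neq0_real R)).
Qed.

(** Coordinate 0 receives the product of the real parts and the whole inner
    product, every other coordinate two products. *)
Lemma mul_rest_sum n (x y : cd R n) j : (j < 2 ^ n)%N ->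
  let T := fma_term (cf x) (cf y) in
  T false 0%N 0%N 0%N j + \sum_(k < 2 ^ n - 1)
    (T true 0%N (k + 1)%N (k + 1)%N j
     + (T false (k + 1)%N 0%N (k + 1)%N j + T false (k + 1)%N (k + 1)%N 0%N j))
  = cf (mul_rest x y) j.
Proof.
move=> hj T; have two := two_neq0_real R.
have hd := dot_Im two x y; have hx := cf_Im two x; have hy := cf_Im two y.
rewrite /mul_rest; move: (cdIm x) (cdIm y) hd hx hy => X Y hd hx hy.
rewrite !(cfD, cfZ) cf_scal hx hy /T /fma_term; case: eqP => [->|/eqP j0].
  rewrite hd !mulr0 !addr0 -subn1 -sumrN; congr (_ + _); apply: eq_bigr => k _.
  by rewrite addn1 /= !addr0.
rewrite !add0r; pose F k := cf x 0 * cf y k + cf y 0 * cf x k.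
transitivity (\sum_(k < 2 ^ n - 1) (if j == k.+1 then F k.+1 else 0)).
  apply: eq_bigr => k _; rewrite addn1 add0r.
  by case: eqP => _; rewrite /F; ring.
by rewrite sum_delta; have -> : (0 < j <= 2 ^ n - 1)%N by lia.
Qed.

Lemma workspace_le n : (workspace n <= 8 * 2 ^ n)%N.
Proof.
have h : (n < 2 ^ n)%N by exact: ltn_expl.
suff e : (workspace n + 4 = 4 * n + 4 * 2 ^ n)%N by lia.
by elim: n {h} => [//|n IH]; rewrite [workspace _]/= !expnS; lia.
Qed.

Lemma exec_M n s x y z w g (X Y : cd R n) : (0 < n)%N ->
  (x + 2 ^ n <= z)%N -> (y + 2 ^ n <= z)%N -> (z + 2 ^ n <= w)%N ->
  (w + (2 + 4 * 2 ^ n + workspace n.-1) <= s)%N ->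
  storedR g x X -> storedR g y Y ->
  exists g' k, [/\ exec P [:: n; x; y; z; w] (P AlgM) (mkseq g s) (mkseq g' s) k
      (1 + 3 * (2 ^ n).-1 + real_cross_count n) (subcalls (treeM X Y)),
    (k <= 50 * (n * 2 ^ n))%N, storedR g' z (cdmul X Y) & keeps z w (2 ^ n)%N g g'].
Proof.
move=> n0 xz yz zw ws sx sy; set env := [:: n; x; y; z; w]; set N := (2 ^ n)%N.
have N0 : (0 < N)%N by rewrite expn_gt0.
pose A := (w + 1)%N; pose B := (A + N)%N; pose W := (B + N)%N.
rewrite -/N in xz yz zw ws.
pose eAx := wsp :+ INat 1; pose eBx := eAx :+ fdim; pose eWx := eBx :+ fdim.
have eA : extends eAx env A by split.
have eB : extends eBx env B by split.
have eW : ieval env eWx = W by [].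
have ex : extends opx env x by split.
have ey : extends opy env y by split.
have two := two_neq0_real R.
pose cp src dst := copy_but R src dst fdim (INat 0).
pose g1 := run env (cp opx eAx) g.
have [s1 k1] : storedR g1 A (cdIm X) /\ forall c, (c < A \/ A + N <= c)%N -> g1 c = g c.
  by exact: (copy_stored_Im ex eA ltac:(lia) sx).
have sy1 : storedR g1 y Y by apply: (storedR_eq sy) => i hi; apply: k1; lia.
pose g2 := run env (cp opy eBx) g1.
have [s2 k2] : storedR g2 B (cdIm Y) /\ forall c, (c < B \/ B + N <= c)%N -> g2 c = g1 c.
  by exact: (copy_stored_Im ey eB ltac:(lia) sy1).
have s12 : storedR g2 A (cdIm X) by apply: (storedR_eq s1) => i hi; apply: k2; lia.
have lay : layout N z A B W s (1 + 2 * N + workspace n.-1) by split; lia.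
have [g3 [c3 [x3 b3 z3 f3]]] := call_R (exec_R n0) (erefl : ieval env lev = n)
  (erefl : ieval env eAx = A) (erefl : ieval env eBx = B) (erefl : ieval env res = z) eW
  (imag_Im two X) (imag_Im two Y) lay s12 s2.
have k3 c : (c < w)%N -> (c < z \/ z + N <= c)%N -> g3 c = g c.
  move=> hc1 hc2; rewrite f3; last by rewrite /outside -/N; lia.
  by rewrite k2 ?k1 //; lia.
have ox i : (i < 2 ^ n)%N -> outside z (2 ^ n) w (x + i) by rewrite /outside -/N; lia.
have oy i : (i < 2 ^ n)%N -> outside z (2 ^ n) w (y + i) by rewrite /outside -/N; lia.
have in3 : inputs (@viewR R) n x y (cf X) (cf Y) g3.
  move=> i hi; split; first by apply: (storedR_eq sx) => // l hl; apply: k3; lia.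
  by apply: (storedR_eq sy) => // l hl; apply: k3; lia.
have vk := viewR_keeps (xi := cf X) (eta := cf Y) ox oy.
have fma := fmaR_correct (xi := cf X) (eta := cf Y) (x := x) (y := y) zw.
pose i1 := idx :+ INat 1.
pose body := (fmaR R true (INat 0) i1 i1 ;; fmaR R false i1 (INat 0) i1 ;;
  fmaR R false i1 i1 (INat 0)).
pose T := fma_term (cf X) (cf Y).
have hbody i : (i < N - 1)%N -> adds (@viewR R) n x y z w N (cf X) (cf Y)
    [:: n; x; y; z; w; i] body (fun j => T true 0%N (i + 1)%N (i + 1)%N j
     + (T false (i + 1)%N 0%N (i + 1)%N j + T false (i + 1)%N (i + 1)%N 0%N j)).
  move=> hi; do 2! (apply: (adds_seq vk);
    first by apply: fma; [exists [:: i] | rewrite /= -/N; lia ..]).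
  by apply: fma; [exists [:: i] | rewrite /= -/N; lia ..].
have h4 : adds (@viewR R) n x y z w N (cf X) (cf Y) env
    (fmaR R false (INat 0) (INat 0) (INat 0)) (T false 0%N 0%N 0%N).
  by apply: fma; [exists [::] | rewrite /= -/N; lia ..].
have h5 := adds_for vk (e := ISub fdim (INat 1)) (env := env) hbody.
have [k5 v5] := adds_seq vk h4 h5 in3.
rewrite run_seq in k5 v5.
set g4 := run _ _ g3 in k5 v5; set g5 := run _ _ g4 in k5 v5.
have ecp src dst sa d g0 (h1 : extends src env sa) (h2 : extends dst env d) :
    (sa + N <= s)%N -> (d + N <= s)%N ->
    exec P env (cp src dst) (mkseq g0 s) (mkseq (run env (cp src dst) g0) s) 0 0 [::].
  move=> a b.
  have := exec_run P g0 (safe_copy_but R (k := INat 0) h1 h2 (erefl (ieval env fdim)) N0 a b).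
  by rewrite ops_copy_but prods_copy_but.
have e1 := ecp _ _ _ _ g ex eA ltac:(lia) ltac:(lia).
have e2 := ecp _ _ _ _ g1 ey eB ltac:(lia) ltac:(lia).
have e4 : exec P env (fmaR R false (INat 0) (INat 0) (INat 0)) (mkseq g3 s) (mkseq g4 s) 2 1 [::].
  by apply: (exec_run P g3); rewrite /=; do !split; lia.
have e5 : exec P env (For (ISub fdim (INat 1)) body) (mkseq g4 s) (mkseq g5 s)
    (6 * (N - 1)) (3 * (N - 1)) [::].
  have hs : safe env s (For (ISub fdim (INat 1)) body).
    by rewrite /= -/N => i hi; do !split; lia.
  by have := exec_run P g4 hs; rewrite /= !sum_nat_const !card_ord -/N !(mulnC (N - 1)%N).
have he := ESeq (e1 : exec _ _ _ _ (mkseq g1 s) _ _ _)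
  (ESeq (e2 : exec _ _ _ _ (mkseq g2 s) _ _ _) (ESeq x3 (ESeq e4 e5))).
have ep : (1 + 3 * N.-1 + real_cross_count n =
    0 + (0 + (real_cross_count n + (1 + 3 * (N - 1)))))%N by lia.
eexists g5, _; split.
- rewrite ep; have -> : subcalls (treeM X Y) = [:: treeR (cdIm X) (cdIm Y)].
    by rewrite /treeM /= eqn0Ngt n0.
  exact: he.
- by move: b3; rewrite -/N; nia.
- move=> j hj; rewrite v5 // (z3 j hj) cdmul_rest // [RHS]cfD -mul_rest_sum //.
- by move=> c hc; rewrite k5 // k3 //; move: hc; rewrite /outside -/N; lia.
Qed.

Lemma program_implements_M n : (0 < n)%N ->
  implements_M P n (2 + 4 * 2 ^ n + workspace n.-1) (50 * (n * 2 ^ n)).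
Proof.
move=> n0 x y z0 w0 sz sw; set N := (2 ^ n)%N in sz *; set mem := _ ++ _.
have smem : size mem = (3 * N + size w0)%N.
  by rewrite /mem !size_cat !size_coeffs sz -/N; clear; move: (size w0); lia.
pose g := nth 0 mem; set s := size mem in smem.
have emem : mem = mkseq g s by rewrite mkseq_nth.
have sx : storedR g 0 x.
  by move=> i hi; rewrite /viewR /g /mem nth_cat size_coeffs hi.
have sy : storedR g N y.
  by move=> i hi; rewrite /viewR /g /mem nth_cat size_coeffs ltnNge leq_addr addKn
    nth_cat size_coeffs hi.
have [||||g' [k [hx hk st kp]]] := @exec_M n s 0 N (2 * N) (3 * N) g x y n0 _ _ _ _ sx sy;
  rewrite -/N; try lia.
have sx' : storedR g' 0 x.
  by apply: (storedR_eq sx) => i hi; apply: kp; move: hi; rewrite /outside -/N; lia.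
have sy' : storedR g' N y.
  by apply: (storedR_eq sy) => i hi; apply: kp; move: hi; rewrite /outside -/N; lia.
exists (drop (3 * N) (mkseq g' s)), k, (1 + 3 * N.-1 + real_cross_count n)%N.
split=> //; last by rewrite mul_lengthE.
have -> : treeM x y = CallNode AlgM n (slice mem 0 N) (slice mem N N)
    (slice (mkseq g' s) (2 * N) N) (subcalls (treeM x y)).
  rewrite emem (slice_storedR sx) ?(slice_storedR sy) ?(slice_storedR st); try lia.
  by rewrite -algM_mul.
have -> : coeffs x ++ coeffs y ++ coeffs (cdmul x y) ++ drop (3 * N) (mkseq g' s) = mkseq g' s.
  rewrite -(slice_storedR (S := s) sx') -?(slice_storedR (S := s) sy')
    -?(slice_storedR (S := s) st) -/N; try lia.
  have cut a : take N (drop a (mkseq g' s)) ++ drop (N + a) (mkseq g' s) = drop a (mkseq g' s).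
    by rewrite -drop_drop cat_take_drop.
  rewrite /slice; have -> : (3 * N = N + 2 * N)%N by lia.
  rewrite cut; have -> : (2 * N = N + N)%N by lia.
  by rewrite cut drop0 cat_take_drop.
rewrite emem; exact: (@ECall R P [::] AlgM (INat n) (INat 0) (INat N) (INat (2 * N))
  (INat (3 * N)) (mkseq g s) (mkseq g' s) k _ _ hx).
Qed.

End Product.

Theorem theorem1p1 (R : realType) :
  (forall n : nat, (1 <= n)%N ->
     exists2 r : nat, r%:Z <= (9 * n%:Z - 15) * (2 ^ n.-1)%:Z + 10
                    & has_bilinear_algorithm (@cdmul R n) r)
  /\
  (exists (P : program R) (c : nat), forall n : nat, (1 <= n)%N ->
     exists2 aux : nat, (aux <= c * 2 ^ n)%N
                      & implements_M P n aux (c * (n * 2 ^ n))).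
Proof.
split=> [n n0|].
  exists (1 + 3 * (2 ^ n).-1 + real_cross_count n)%N.
    by rewrite (mul_lengthE n0).
  exact: has_bilinear_algorithmP (bilin_cdmul R n0).
exists (cd_program R), 50%N => n n0.
exists (2 + 4 * 2 ^ n + workspace n.-1)%N; last exact: program_implements_M.
have := workspace_le n.-1; have e : (2 ^ n = 2 * 2 ^ n.-1)%N by rewrite -expnS prednK.
by have : (0 < 2 ^ n.-1)%N by [rewrite expn_gt0]; lia.
Qed.
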